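(* Under the standing setup below (with $\mathbf q$, $A$, $D$ as there and $q=N_{K_p/\mathbb Q}(\mathbf q)$), one has the equality in $K_{pq}$ $$\Big(\frac{g(\mathbf q)}{\overline{g(\mathbf q)}}\Big)^{p^2}=\Big(\frac{A^2}{D^p}\Big)^{P(\sigma)},$$ where the bar denotes complex conjugation and $x^{P(\sigma)}=\prod_{i=0}^{p-2}\sigma^i(x)^{v^{-i}}$.
   Context: Let $p$ be an odd prime, $\zeta_p$ a primitive $p$-th root of unity, $K_p=\mathbb Q(\zeta_p)$ with ring of integers $\mathbb Z[\zeta_p]$, $K_p^+$ its maximal totally real subfield, $\lambda=\zeta_p-1$, $\pi=\lambda\mathbb Z[\zeta_p]$; $\pi^k\,\|\,x$ means $x\in\pi^k$, $x\notin\pi^{k+1}$. Fix a primitive root $v$ modulo $p$; for $n\in\mathbb Z$, $v^n$ denotes the integer in $\{1,\dots,p-1\}$ congruent to $v^n$ modulo $p$ (for $n<0$ using the inverse of $v$ mod $p$). Let $\sigma\in G_p=\mathrm{Gal}(K_p/\mathbb Q)$ be $\zeta_p\mapsto\zeta_p^v$ and $P(\sigma)=\sum_{i=0}^{p-2}v^{-i}\sigma^i\in\mathbb Z[G_p]$. Gauss sum: for an odd prime $q\ne p$, $\zeta_q$ a primitive $q$-th root of unity, $K_{pq}=\mathbb Q(\zeta_p,\zeta_q)$, and a prime $\mathbf q$ of $\mathbb Z[\zeta_p]$ over $q$ with $N=N\mathbf q$, let $\chi(a)=\{\alpha/\mathbf q\}_p^{-1}$ where $\{\alpha/\mathbf q\}_p$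 is the $p$-th root of unity $\equiv\alpha^{(N-1)/p}\bmod\mathbf q$ ($a\neq0$ the image of $\alpha$ in $\mathbb F_N=\mathbb Z[\zeta_p]/\mathbf q$), $\chi(0)=0$, and $g(\mathbf q)=\sum_{x\in\mathbb F_N}\chi(x)\zeta_q^{\mathrm{Tr}_{\mathbb F_N/\mathbb F_q}(x)}$. Standing setup: assume $p$ is irregular and $p$ does not divide the class number of $K_p^+$. Let $C_p$ be the $p$-Sylow subgroup of the ideal class group of $K_p$, $m$ an integer with $1\le m\le\frac{p-3}{2}$, $\mu=v^{2m+1}$, and $\Gamma\subset C_p$ a subgroup of order $p$ annihilated by $\sigma-\mu$. Let $\mathbf q$ be a non-principal prime ideal of $\mathbb Z[\zeta_p]$ of inertial degree $1$ (so $N\mathbf q=q\equiv1\pmod p$) whose class lies in $\Gamma$, and let $A\in\mathbb Z[\zeta_p]$ with $A\mathbb Z[\zeta_p]=\mathbf q^p$, $\sigma(A)=A^{\mu}\alpha^p$ for some $\alpha\in K_p$, $\pi^{2m+1}\,\|\,A-1$, and $A\overline A=D^p$ for some $D$ in the ring of integers of $K_p^+$. *)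

(* Defs.v *)
(* algebraic numbers algC as ambient field containing K_{pq}. *)
From HB Require Import structures.
From mathcomp Require Import all_boot all_order all_algebra algC algnum.
From Stdlib Require Import ClassicalEpsilon.
Set Implicit Arguments. Unset Strict Implicit. Unset Printing Implicit Defensive.
Import Order.TTheory GRing.Theory Num.Theory.
Local Open Scope ring_scope.

Definition inKp (zp x : algC) : Prop :=
  exists c : seq rat, x = \sum_(i < size c) ratr c`_i * zp ^+ i.

Definition inKplus (zp x : algC) : Prop := inKp zp x /\ x^* = x.

Definition OK (zp x : algC) : Prop := inKp zp x /\ x \in Aint.

Definition OKplus (zp x : algC) : Prop := inKplus zp x /\ x \in Aint.

Definition ideal (O I : algC -> Prop) : Prop :=
  (forall x, I x -> O x) /\ I 0 /\ (forall x y, I x -> I y -> I (x + y)) /\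
  (forall r x, O r -> I x -> I (r * x)).

Definition nzideal (O I : algC -> Prop) : Prop :=
  ideal O I /\ exists x, I x /\ x <> 0.

Definition ideal_eq (I J : algC -> Prop) : Prop := forall x, I x <-> J x.

Definition pideal (O : algC -> Prop) (a : algC) : algC -> Prop :=
  fun x => exists r, O r /\ x = a * r.

Definition is_principal (O I : algC -> Prop) : Prop :=
  exists a, O a /\ ideal_eq I (pideal O a).

Definition iprod (I J : algC -> Prop) : algC -> Prop :=
  fun x => exists s : seq (algC * algC),
    (forall ab, ab \in s -> I ab.1 /\ J ab.2) /\ x = \sum_(ab <- s) ab.1 * ab.2.

Definition ipow (O I : algC -> Prop) (n : nat) : algC -> Prop :=
  iter n (iprod I) O.

Definition iimage (s : algC -> algC) (I : algC -> Prop) : algC -> Prop :=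
  fun x => exists y, I y /\ x = s y.

Definition prime_ideal (O P : algC -> Prop) : Prop :=
  nzideal O P /\ ~ P 1 /\
  (forall a b, O a -> O b -> P (a * b) -> P a \/ P b).

Definition iequiv (O I J : algC -> Prop) : Prop :=
  exists a b, O a /\ O b /\ a <> 0 /\ b <> 0 /\
    (forall x, (exists y, I y /\ x = a * y) <-> (exists y, J y /\ x = b * y)).

Definition nclasses (O : algC -> Prop) (G : (algC -> Prop) -> Prop) (n : nat)
  : Prop :=
  exists R : nat -> (algC -> Prop),
    (forall i, (i < n)%N -> G (R i)) /\
    (forall i j, (i < n)%N -> (j < n)%N -> iequiv O (R i) (R j) -> i = j) /\
    (forall I, G I -> exists2 i, (i < n)%N & iequiv O I (R i)).

Definition class_number (O : algC -> Prop) (h : nat) : Prop :=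
  nclasses O (nzideal O) h.

Definition ideal_norm (O I : algC -> Prop) (N : nat) : Prop :=
  exists R : nat -> algC,
    (forall i, (i < N)%N -> O (R i)) /\
    (forall i j, (i < N)%N -> (j < N)%N -> I (R i - R j) -> i = j) /\
    (forall x, O x -> exists2 i, (i < N)%N & I (x - R i)).

Definition primitive_root_mod (p v : nat) : Prop :=
  (p.-1).-primitive_root (v%:R : 'F_p).

(* v^n (n : int, negative n using the inverse of v mod p), as the integer
   in {1,...,p-1} (for v a primitive root) congruent to it mod p *)
Definition vpow (p v : nat) (n : int) : nat :=
  nat_of_ord ((v%:R : 'F_p) ^ n).

Definition Psigma (p v : nat) (sigma : algC -> algC) (x : algC) : algC :=
  \prod_(i < p.-1) (iter i sigma x) ^+ vpow p v (- (i%:Z)).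

Definition in_pi_pow (zp : algC) (k : nat) (x : algC) : Prop :=
  ipow (OK zp) (pideal (OK zp) (zp - 1)) k x.

Definition pi_exact (zp : algC) (k : nat) (x : algC) : Prop :=
  in_pi_pow zp k x /\ ~ in_pi_pow zp k.+1 x.

Definition power_residue (p : nat) (qI : algC -> Prop) (N : nat) (a : algC)
  : algC :=
  epsilon (inhabits 0)
    (fun w : algC => w ^+ p = 1 /\ qI (a ^+ ((N - 1) %/ p) - w)).

(* chi(a) = {a/qI}_p^{-1}, chi(0) = 0 ; a given by an integer representative *)
Definition chi (p : nat) (qI : algC -> Prop) (N : nat) (x : nat) : algC :=
  if (x %% N == 0)%N then 0 else (power_residue p qI N (x%:R : algC))^-1.

(* Gauss sum g(qI) for qI of residue degree 1, N = q: the residue field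
   F_N = O_K/qI is F_q, represented by the integers 0..q-1, and the trace
   F_N -> F_q is the identity. *)
Definition gauss (p : nat) (zq : algC) (qI : algC -> Prop) (N : nat) : algC :=
  \sum_(x < N) chi p qI N x * zq ^+ x.

(* Main.v *)
Require Import Defs.
From HB Require Import structures.
From mathcomp Require Import all_boot all_order all_algebra algC algnum.
From mathcomp Require Import finfield zify ring.
From Stdlib Require Import ClassicalEpsilon.
Set Implicit Arguments. Unset Strict Implicit. Unset Printing Implicit Defensive.
Import Order.TTheory GRing.Theory Num.Theory.
Local Open Scope ring_scope.

(* Put B = A^{P(sigma)} and g = g(q). The proof shows the sharper g^{p^2} = - B;
   the theorem follows since A * conj A = D^p.

   Stickelberger's congruence is replaced by divisibility of algebraic integers.
   Let gam^{p^2} = A. Every x in qI satisfies A | x^p, and q | (s - 1)^{q-1} for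
   a primitive q-th root of unity s. Expand s^x = (1 + (s - 1))^x in
   the Gauss sum of chi^t. The coefficients of (s - 1)^j with j < t(q-1)/p lie
   in qI, because power sums over F_q vanish. So gam^t divides the sum,
   hence sigma^i(A)^{v^{-i}} | g^{p^2} for all i. The conjugates of A are
   pairwise comaximal, so B | g^{p^2}, say g^{p^2} = u B.

   The norm of A is q^p, so u * conj u = 1, and the same holds for all conjugates
   of u. Modulo pi^2 one has g^p = -1 and B = 1, so w = - u is 1 modulo pi^2. Then
   w^{p^n} - 1 is divisible by arbitrarily high powers of p while its conjugates
   stay bounded by 2, so it vanishes for large n; and no p-th root of unity other
   than 1 is congruent to 1 modulo pi^2, so w = 1. *)

(** * Divisibility among algebraic integers *)

Lemma dvdAP (e x : algC) :
  reflect (exists2 c, c \in Aint & x = e * c) (e %| x)%A.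
Proof.
rewrite unfold_in; case: eqP => [->|/eqP e0].
  by apply: (iffP eqP) => [->|[c _ ->]]; [exists 0|]; rewrite ?mul0r.
apply: (iffP idP) => [xe|[c Zc ->]]; last by rewrite mulrAC divff ?mul1r.
by exists (x / e); rewrite // mulrC divfK.
Qed.

(** Substituting ['X^n] into the minimal polynomial of [x ^+ n] keeps it monic with integral
    coefficients. *)
Lemma Aint_root n (x : algC) : (0 < n)%N -> x ^+ n \in Aint -> x \in Aint.
Proof.
move=> n0 Zx; apply: (@root_monic_Aint (minCpoly (x ^+ n) \Po 'X^n)).
- by rewrite /root horner_comp hornerXn; apply: root_minCpoly.
- rewrite monicE lead_coef_comp ?size_polyXn // lead_coefXn expr1n mulr1.
  exact: minCpoly_monic.
- by apply: polyOver_comp; rewrite ?rpredX ?polyOverX.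
Qed.

Lemma dvdA_mulr (e x y : algC) : (e %| x)%A -> y \in Aint -> (e %| x * y)%A.
Proof.
move=> /dvdAP[c Zc ->] Zy; apply/dvdAP; exists (c * y); last by rewrite mulrA.
exact: rpredM.
Qed.

Lemma dvdA_mull (e x y : algC) : (e %| y)%A -> x \in Aint -> (e %| x * y)%A.
Proof. by rewrite mulrC; apply: dvdA_mulr. Qed.

Lemma dvdA_trans (y x z : algC) : (x %| y)%A -> (y %| z)%A -> (x %| z)%A.
Proof. by move=> xy /dvdAP[c Zc ->]; apply: dvdA_mulr. Qed.

Lemma dvdAA (x : algC) : (x %| x)%A.
Proof. by apply/dvdAP; exists 1; rewrite ?mulr1. Qed.

Lemma dvdA_mul (a b x y : algC) :
  (a %| x)%A -> (b %| y)%A -> ((a * b)%R %| x * y)%A.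
Proof.
move=> /dvdAP[c Zc ->] /dvdAP[d Zd ->]; apply/dvdAP.
by exists (c * d); rewrite ?rpredM // mulrACA.
Qed.

Lemma dvdA_exp n (a x : algC) : (a %| x)%A -> ((a ^+ n)%R %| x ^+ n)%A.
Proof.
move=> /dvdAP[c Zc ->]; apply/dvdAP.
by exists (c ^+ n); rewrite ?rpredX // exprMn.
Qed.

Lemma dvdA_expW m n (a : algC) : a \in Aint -> (m <= n)%N ->
  ((a ^+ m)%R %| a ^+ n)%A.
Proof.
move=> Za lmn; apply/dvdAP; exists (a ^+ (n - m)); first exact: rpredX.
by rewrite -exprD subnKC.
Qed.

(** The quotient [x / a] has an integral [n]-th power, hence is integral. This allows divisibilities
    to be proved after raising to a power. *)
Lemma dvdA_exp_root n (a x : algC) : (0 < n)%N ->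
  ((a ^+ n)%R %| x ^+ n)%A -> (a %| x)%A.
Proof.
move=> n0 /dvdAP[c Zc e]; apply/dvdAP; case: (eqVneq a 0) e => [->|a0] e.
  have: x ^+ n == 0 by rewrite e expr0n eqn0Ngt n0 mul0r.
  by rewrite expf_eq0 n0 => /eqP->; exists 0; rewrite ?mul0r.
exists (x / a); last by rewrite mulrC divfK.
by apply: (Aint_root n0); rewrite exprMn e exprVn mulrAC divff ?mul1r ?expf_neq0.
Qed.

Lemma rmorph_dvdA (nu : {rmorphism algC -> algC}) (e x : algC) :
  (e %| x)%A -> (nu e %| nu x)%A.
Proof.
move=> /dvdAP[c Zc ->]; apply/dvdAP; exists (nu c); rewrite ?Aint_aut //.
exact: rmorphM.
Qed.

Lemma dvdA_prod (I : Type) (r : seq I) (P : pred I) (a x : I -> algC) :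
  (forall i, P i -> (a i %| x i)%A) ->
  ((\prod_(i <- r | P i) a i)%R %| \prod_(i <- r | P i) x i)%A.
Proof.
move=> ax; elim/big_ind2: _ => [|*|//]; first exact: dvdAA.
exact: dvdA_mul.
Qed.

Lemma eqAmodX n (e a b : algC) : a \in Aint -> b \in Aint ->
  (a == b %[mod e])%A -> (a ^+ n == b ^+ n %[mod e])%A.
Proof.
move=> Za Zb ab; elim: n => [|n IH]; first by rewrite !expr0.
by rewrite !exprS; apply: eqAmodM; rewrite ?rpredX.
Qed.

Lemma eqAmod_dvd (d e x y : algC) :
  (d %| e)%A -> (x == y %[mod e])%A -> (x == y %[mod d])%A.
Proof. exact: dvdA_trans. Qed.

(** * Comaximal algebraic integers *)

Definition comaximal (a b : algC) : Prop :=
  exists x y, [/\ x \in Aint, y \in Aint & x * a + y * b = 1].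

Lemma comaximalC a b : comaximal a b -> comaximal b a.
Proof. by case=> x [y [Zx Zy e]]; exists y, x; split; rewrite // addrC. Qed.

Lemma comaximal1 a : comaximal a 1.
Proof. by exists 0, 1; split; rewrite // mul0r mulr1 add0r. Qed.

Lemma comaximalM a b c : a \in Aint -> b \in Aint -> c \in Aint ->
  comaximal a b -> comaximal a c -> comaximal a (b * c).
Proof.
move=> Za Zb Zc [x [y [Zx Zy e1]]] [z [t [Zz Zt e2]]].
exists (x * z * a + x * t * c + y * b * z), (y * t); split.
- by rewrite !rpredD ?rpredM.
- exact: rpredM.
- by rewrite -[RHS]mulr1 -{1}e1 -e2; ring.
Qed.

Lemma comaximalX n a b : a \in Aint -> b \in Aint ->
  comaximal a b -> comaximal a (b ^+ n).
Proof.
move=> Za Zb ab; elim: n => [|n IH]; first exact: comaximal1.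
by rewrite exprS; apply: comaximalM; rewrite ?rpredX.
Qed.

(** Multiplying the Bezout relation by [x] gives two terms, each a multiple of [a * b]. *)
Lemma comaximal_dvdA a b x : comaximal a b ->
  (a %| x)%A -> (b %| x)%A -> ((a * b)%R %| x)%A.
Proof.
case=> y [z [Zy Zz e]] ax bx; rewrite -[x]mul1r -e mulrDl.
apply: rpredD.
  rewrite (_ : _ * x = y * (a * x)); last by ring.
  by rewrite dvdA_mull // dvdA_mul // dvdAA.
rewrite (_ : _ * x = z * (x * b)); last by ring.
by rewrite dvdA_mull // dvdA_mul // dvdAA.
Qed.

Lemma comaximal_dvdW a b c d : (a %| c)%A -> (b %| d)%A -> 
  comaximal c d -> comaximal a b.
Proof.
move=> /dvdAP[u Zu ->] /dvdAP[w Zw ->] [x [y [Zx Zy e]]].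
exists (x * u), (y * w); split; rewrite ?rpredM //.
by rewrite -e; ring.
Qed.

Lemma comaximal_prod (I : eqType) (r : seq I) (F : I -> algC) a :
  a \in Aint -> (forall i, F i \in Aint) ->
  (forall i, i \in r -> comaximal a (F i)) -> comaximal a (\prod_(i <- r) F i).
Proof.
move=> Za ZF; elim: r => [|i r IH] H; first by rewrite big_nil; apply: comaximal1.
rewrite big_cons; apply: comaximalM; rewrite ?rpred_prod //.
  by apply: H; rewrite mem_head.
by apply: IH => j jr; apply: H; rewrite inE jr orbT.
Qed.

Lemma prod_comaximal_dvdA (I : eqType) (r : seq I) (F : I -> algC) x :
  uniq r -> (forall i, F i \in Aint) ->
  (forall i j, i \in r -> j \in r -> i != j -> comaximal (F i) (F j)) ->
  x \in Aint ->
  (forall i, i \in r -> (F i %| x)%A) -> ((\prod_(i <- r) F i)%R %| x)%A.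
Proof.
move=> ur ZF cF Zx; elim: r ur cF => [|i r IH] /=.
  by move=> _ _ _; rewrite big_nil; apply/dvdAP; exists x; rewrite ?mul1r.
case/andP=> ir ur cF H; rewrite big_cons; apply: comaximal_dvdA.
- apply: comaximal_prod => // j jr; apply: cF; rewrite ?mem_head //.
    by rewrite inE jr orbT.
  by apply: contraNneq ir => ->.
- by apply: H; rewrite mem_head.
- apply: IH => // [j k jr kr|j jr]; last by apply: H; rewrite inE jr orbT.
  by apply: cF; rewrite inE ?jr ?kr orbT.
Qed.

(** * Sums and products over prime fields *)

Lemma big_Fp (R : Type) (idx : R) (op : R -> R -> R) p (F : nat -> R) :
  prime p -> \big[op/idx]_(x : 'F_p) F x = \big[op/idx]_(i < p) F i.
Proof.
by move=> pr_p; rewrite -(big_mkord xpredT F) -(big_mkord xpredT F) Fp_cast.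
Qed.

Lemma primitive_root_mod_exp_inj p v : prime p -> primitive_root_mod p v ->
  {in gtn p.-1 &, injective (fun i => (v%:R : 'F_p) ^+ i)}.
Proof.
move=> pr_p vP i j ip jp /eqP; rewrite (eq_prim_root_expr vP).
by rewrite !modn_small // => /eqP.
Qed.

(** The first [p.-1] powers of [v] are distinct and nonzero, so they exhaust the nonzero residues.
    Products over the Galois group thereby become products over these residues. *)
Lemma big_primitive_root_mod (R : Type) (idx : R) (op : Monoid.com_law idx)
  p v (F : 'F_p -> R) : prime p -> primitive_root_mod p v ->
  \big[op/idx]_(i < p.-1) F (v%:R ^+ i) = \big[op/idx]_(x : 'F_p | x != 0) F x.
Proof.
move=> pr_p vP.
have v0 : v%:R != 0 :> 'F_p.
  apply/eqP=> v0; move: (prim_expr_order vP) (prim_order_gt0 vP).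
  by case: p.-1 => // n; rewrite v0 expr0n => /eqP; rewrite eq_sym oner_eq0.
rewrite -(big_mkord xpredT (fun i => F (v%:R ^+ i))) /index_iota subn0.
rewrite -(big_map (fun i => v%:R ^+ i) xpredT F).
transitivity (\big[op/idx]_(x in predC1 (0 : 'F_p)) F x); last exact: eq_bigl.
rewrite -big_enum /=.
set s := [seq _ | _ <- _]; have us : uniq s.
  rewrite map_inj_in_uniq ?iota_uniq // => i j; rewrite !mem_iota /= !add0n.
  exact: (primitive_root_mod_exp_inj pr_p vP).
have ss : {subset s <= enum (predC1 (0 : 'F_p))}.
  by move=> _ /mapP[i _ ->]; rewrite mem_enum inE expf_neq0.
apply: perm_big; apply: uniq_perm; rewrite ?enum_uniq //.
have /(uniq_min_size us ss)[//] : (size (enum (predC1 (0%R : 'F_p))) <= size s)%N.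
by rewrite size_map size_iota -cardE cardC1 card_Fp.
Qed.

Lemma sum_exp_eq1 (R : idomainType) n (w : R) :
  w ^+ n = 1 -> w != 1 -> \sum_(i < n) w ^+ i = 0.
Proof.
move=> wn w1; have /eqP := subrX1 w n.
by rewrite wn subrr eq_sym mulf_eq0 subr_eq0 (negPf w1) => /eqP.
Qed.

Lemma prime_prim_root (F : fieldType) p (z : F) :
  prime p -> z ^+ p = 1 -> z != 1 -> p.-primitive_root z.
Proof.
move=> pr_p zp z1; have [m mP mp] := prim_order_exists (prime_gt0 pr_p) zp.
have [_ /(_ _ mp)/pred2P[m1|<- //]] := primeP pr_p.
by case/eqP: z1; have := prim_expr_order mP; rewrite m1 expr1.
Qed.

(** Otherwise ['X^i - 1] would have [q.-1] roots, more than its degree. *)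
Lemma Fp_exp_neq1 q i : prime q -> (0 < i < q.-1)%N ->
  exists2 a : 'F_q, a != 0 & a ^+ i != 1.
Proof.
move=> pr_q /andP[i0 iq]; apply/exists_inP; apply: contraLR iq.
rewrite negb_exists_in -leqNgt => /forall_inP H.
have sz : size ('X^i - 1 : {poly 'F_q}) = i.+1 by rewrite -polyC1 size_XnsubC.
have nz : 'X^i - 1 != 0 :> {poly 'F_q} by rewrite -size_poly_eq0 sz.
have rt : all (root ('X^i - 1)) (enum (predC1 (0 : 'F_q))).
  apply/allP=> x; rewrite mem_enum inE => x0.
  by rewrite /root !hornerE subr_eq0 -[_ == _]negbK H.
by have := max_poly_roots nz rt (enum_uniq _); rewrite sz -cardE cardC1 card_Fp.
Qed.

(** It suffices to treat monomials of degree [i < q.-1]. For [i = 0] the sum is [q = 0]; otherwise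
    the substitution of [a * x] for [x] multiplies it by some [a ^+ i != 1]. *)
Lemma sum_Fp_poly q (P : {poly 'F_q}) : prime q -> (size P < q)%N ->
  \sum_(x : 'F_q) P.[x] = 0.
Proof.
move=> pr_q sP; under eq_bigr => x _ do rewrite horner_coef.
rewrite exchange_big big1 //= => i _; rewrite -mulr_sumr.
suff -> : \sum_(x : 'F_q) x ^+ i = 0 by rewrite mulr0.
have [->|i0] := posnP i.
  under eq_bigr do rewrite expr0.
  by rewrite sumr_const card_Fp // pchar_Fp_0.
have iq : (i < q.-1)%N.
  by rewrite -ltnS prednK ?prime_gt0 // (leq_trans _ sP) // ltnS.
have [a a0 ai] := Fp_exp_neq1 pr_q (introT andP (conj i0 iq)).
have : a ^+ i * (\sum_(x : 'F_q) x ^+ i) = \sum_(x : 'F_q) x ^+ i.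
  rewrite mulr_sumr [RHS](reindex_inj (mulfI a0)) /=.
  by apply: eq_bigr => x _; rewrite exprMn.
move/eqP; rewrite -subr_eq0 -{2}[\sum_x _]mul1r -mulrBl mulf_eq0 subr_eq0.
by rewrite (negPf ai) => /eqP.
Qed.

(** * The cyclotomic field, its automorphisms and its trace *)

(** A boolean form of [inKp], obtained by excluded middle so that it can carry a subring
    structure. *)
Definition Kp (zp : algC) : {pred algC} :=
  fun x => if excluded_middle_informative (inKp zp x) then true else false.

Lemma KpP zp x : reflect (inKp zp x) (x \in Kp zp).
Proof. by rewrite unfold_in; case: excluded_middle_informative => h; constructor. Qed.

Lemma inKp_poly zp x :
  inKp zp x <-> exists P : {poly rat}, x = (map_poly ratr P).[zp].
Proof.
split=> [[c ->]|[P ->]].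
  exists (\poly_(i < size c) c`_i).
  rewrite (@horner_coef_wide _ (size c)); last first.
    by rewrite size_map_poly size_poly.
  by apply: eq_bigr => i _; rewrite coef_map coef_poly ltn_ord.
exists P; rewrite horner_coef size_map_poly.
by apply: eq_bigr => i _; rewrite coef_map.
Qed.

Lemma Kp_subring_closed zp : subring_closed (Kp zp).
Proof.
split=> [|x y|x y].
- by apply/KpP/inKp_poly; exists 1; rewrite rmorph1 hornerC.
- move=> /KpP/inKp_poly[P ->] /KpP/inKp_poly[Q ->].
  by apply/KpP/inKp_poly; exists (P - Q); rewrite rmorphB hornerD hornerN.
- move=> /KpP/inKp_poly[P ->] /KpP/inKp_poly[Q ->].
  by apply/KpP/inKp_poly; exists (P * Q); rewrite rmorphM hornerM.
Qed.
HB.instance Definition _ zp :=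
  GRing.isSubringClosed.Build algC (Kp zp) (Kp_subring_closed zp).

Lemma Kp_gen zp : zp \in Kp zp.
Proof. by apply/KpP/inKp_poly; exists 'X; rewrite map_polyX hornerX. Qed.

Lemma Kp_Crat zp : {subset Crat <= Kp zp}.
Proof.
by move=> _ /CratP[a ->]; apply/KpP/inKp_poly; exists a%:P; rewrite map_polyC hornerC.
Qed.

Lemma Kp_rmorph_ext (f g : {rmorphism algC -> algC}) zp x :
  f zp = g zp -> x \in Kp zp -> f x = g x.
Proof.
move=> fg /KpP[c ->]; rewrite !rmorph_sum; apply: eq_bigr => i _.
by rewrite [LHS]rmorphM [RHS]rmorphM !rmorphXn /= !fmorph_rat fg.
Qed.

(** Iterates of [s] packaged as ring morphisms, so that each power of [sigma] is again a
    morphism. *)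
Fixpoint itermor (s : {rmorphism algC -> algC}) (i : nat) :
    {rmorphism algC -> algC} :=
  if i is j.+1 then s \o itermor s j else idfun.

Lemma itermorE s i x : itermor s i x = iter i s x.
Proof. by elim: i => //= i ->. Qed.

Lemma itermorD s i j x : itermor s (i + j) x = itermor s i (itermor s j x).
Proof. by rewrite !itermorE iterD. Qed.

Lemma ltn_Fp p (x : 'F_p) : prime p -> (x < p)%N.
Proof. by move=> pr_p; rewrite (leq_trans (ltn_ord x)) // Fp_cast. Qed.

Lemma sum_ord_exp_prim p (z : algC) k : p.-primitive_root z -> ~~ (p %| k)%N ->
  \sum_(i < p) z ^+ (k * i) = 0.
Proof.
move=> zP pk; under eq_bigr do rewrite exprM.
by apply: sum_exp_eq1; rewrite -?(prim_order_dvd zP) // exprAC (prim_expr_order zP) expr1n.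
Qed.

Lemma prim_root_neq0 (F : fieldType) n (z : F) : n.-primitive_root z -> z != 0.
Proof.
move=> zP; apply/eqP=> z0; have := prim_expr_order zP.
by rewrite z0 expr0n eqn0Ngt (prim_order_gt0 zP) => /eqP; rewrite eq_sym oner_eq0.
Qed.

Lemma norm_unity_root n (z : algC) : (0 < n)%N -> z ^+ n = 1 -> `|z| = 1.
Proof.
by move=> n0 zn; apply/eqP; rewrite -(pexpr_eq1 n0) // -normrX zn normr1.
Qed.

Lemma conj_unity_root n (z : algC) : (0 < n)%N -> z ^+ n = 1 -> z^* = z^-1.
Proof. by move=> n0 zn; rewrite invC_norm (norm_unity_root n0 zn) expr1n invr1 mul1r. Qed.

Section Cyclotomic.
Variables (p : nat) (zp : algC) (v : nat) (sigma : {rmorphism algC -> algC}).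
Hypotheses (pr_p : prime p) (zpP : p.-primitive_root zp).
Hypotheses (vP : primitive_root_mod p v) (sig : sigma zp = zp ^+ v).

Local Notation tau := (itermor sigma).
Local Notation pi := (zp - 1).

Lemma exp_Fp_nat n : zp ^+ (n%:R : 'F_p) = zp ^+ n.
Proof. by rewrite val_Fp_nat // (prim_expr_mod zpP). Qed.

Lemma tau_zp i : tau i zp = zp ^+ (v%:R ^+ i : 'F_p).
Proof.
rewrite -natrX exp_Fp_nat; elim: i => [|i IH]; first by rewrite expr1.
by rewrite /= IH rmorphXn sig -exprM expnS.
Qed.

Lemma tau_eq_mod i j x : x \in Kp zp -> (i == j %[mod p.-1])%N ->
  tau i x = tau j x.
Proof.
move=> Kx; rewrite -(eq_prim_root_expr vP) => /eqP ij.
by apply: Kp_rmorph_ext Kx; rewrite !tau_zp ij.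
Qed.

Lemma tau_Kp i x : x \in Kp zp -> tau i x \in Kp zp.
Proof.
move=> /KpP[c ->]; rewrite rmorph_sum rpred_sum // => j _.
rewrite rmorphM rmorphXn /= fmorph_rat tau_zp -exprM rpredM ?rpredX ?Kp_gen //.
by rewrite Kp_Crat ?Crat_rat.
Qed.

Lemma prim_tau i : p.-primitive_root (tau i zp).
Proof. by rewrite fmorph_primitive_root. Qed.

Lemma tau_conj i x : x \in Kp zp -> tau i x^* = (tau i x)^*.
Proof.
have p0 := prime_gt0 pr_p; apply: (Kp_rmorph_ext (f := tau i \o Num.conj)
  (g := Num.conj \o tau i)).
rewrite /= (conj_unity_root p0 (prim_expr_order zpP)) fmorphV.
by rewrite (conj_unity_root p0 (prim_expr_order (prim_tau i))).
Qed.

Definition trace x : algC := \sum_(i < p.-1) tau i x.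

(** By linearity only powers of [zp] matter; the sum of [zp ^+ (k * a)] over all residues [a] is [p]
    or 0, and the residue 0 contributes 1. *)
Lemma trace_Crat x : x \in Kp zp -> trace x \in Crat.
Proof.
move=> /KpP[c ->]; rewrite /trace.
under eq_bigr => i _ do rewrite rmorph_sum /=.
rewrite exchange_big rpred_sum //= => k _.
under eq_bigr => i _ do rewrite rmorphM rmorphXn /= fmorph_rat tau_zp -exprM mulnC exprM.
rewrite -mulr_sumr rpredM ?Crat_rat //.
rewrite (big_primitive_root_mod _ (fun x : 'F_p => (zp ^+ k) ^+ x) pr_p vP).
have : \sum_(x : 'F_p) (zp ^+ k) ^+ x \in Crat.
  rewrite (big_Fp _ _ (fun x => (zp ^+ k) ^+ x) pr_p).
  have [/dvdnP[d ->]|pk] := boolP (p %| k)%N.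
    rewrite rpred_sum // => i _; rewrite mulnC exprM (prim_expr_order zpP).
    by rewrite !expr1n rpred1.
  by under eq_bigr do rewrite -exprM; rewrite sum_ord_exp_prim ?rpred0.
by rewrite (bigD1 0) //= expr0 => h; rewrite -(rpredDl _ (rpred1 Crat)).
Qed.

(** Fourier inversion: after exchanging the sums, the geometric sum of ratio [tau i zp / zp]
    vanishes except for [i = 0], where it is [p]. It recovers an element from its traces. *)
Lemma trace_dual x : \sum_(j < p) trace (x * zp ^+ j) * zp^-1 ^+ j = p%:R * x.
Proof.
under eq_bigr => j _ do rewrite /trace mulr_suml.
rewrite exchange_big /=.
under eq_bigr => i _.
  under eq_bigr => j _ do rewrite rmorphM rmorphXn -mulrA -exprMn.
  rewrite -mulr_sumr; over.
have z0 := prim_root_neq0 zpP.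
have p1 : (0 < p.-1)%N by have := prime_gt1 pr_p; lia.
rewrite (bigD1 (Ordinal p1)) //= divff //.
rewrite [X in _ + X]big1 ?addr0 => [|i i0].

  by under eq_bigr do rewrite expr1n; rewrite sumr_const card_ord mulrC.
rewrite sum_exp_eq1 ?mulr0 // ?exprMn ?exprVn.
  by rewrite (prim_expr_order zpP) (prim_expr_order (prim_tau i)) divr1.
apply: contra i0; rewrite -[1](divff z0) (inj_eq (mulIf _)) ?invr_eq0 //.
rewrite tau_zp -[zp in X in _ == X]expr1 (eq_prim_root_expr zpP).
rewrite (modn_small (prime_gt1 pr_p)) modn_small; last first.
  exact: ltn_Fp.
move=> h; apply/eqP/val_inj/eqP => /=.
rewrite -(modn_small (ltn_ord i)) -[0%N](mod0n p.-1) -(eq_prim_root_expr vP).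
rewrite expr0; apply/eqP/val_inj/eqP => /=; rewrite (eqP h).
by have := val_Fp_nat pr_p 1; rewrite modn_small ?prime_gt1 // => ->.
Qed.

End Cyclotomic.

(** * Congruences modulo powers of [zp - 1] *)

Lemma prod_prim_root_sub (R : fieldType) p (z y : R) : p.-primitive_root z ->
  \prod_(1 <= i < p) (y - z ^+ i) = \sum_(i < p) y ^+ i.
Proof.
move=> zP; have p0 := prim_order_gt0 zP.
have e : \prod_(1 <= i < p) ('X - (z ^+ i)%:P) = \sum_(i < p) 'X^i.
  have nz : 'X - 1%:P != 0 :> {poly R} by rewrite polyXsubC_eq0.
  apply: (mulfI nz).
  transitivity ('X^p - 1 : {poly R}); last first.
    by rewrite polyC1; apply: subrX1.
  by rewrite -[RHS](factor_Xn_sub_1 zP) [RHS]big_ltn ?expr0.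
have {e} := congr1 (horner^~ y) e.
rewrite horner_prod horner_sum; under eq_bigr do rewrite hornerXsubC.
by under [RHS]eq_bigr do rewrite hornerXn.
Qed.

Lemma eqAmod_pow1 (z : algC) k : z \in Aint -> (z - 1 %| z ^+ k - 1)%A.
Proof.
move=> Zz; rewrite subrX1 dvdA_mulr ?dvdAA // rpred_sum // => i _.
exact: rpredX.
Qed.

Lemma dvdA_sub1C (x y : algC) : (1 - x %| y)%A = (x - 1 %| y)%A.
Proof.
by apply/dvdAP/dvdAP=> -[c Zc ->]; exists (- c); rewrite ?rpredN //; ring.
Qed.

(** [p] is the product of the [1 - z ^+ i], and each factor divides [z - 1] because [z] is in turn a
    power of [z ^+ i]. *)
Lemma dvdA_prime_prim_root p (z : algC) : prime p -> p.-primitive_root z ->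
  (p%:R %| (z - 1) ^+ p.-1)%A.
Proof.
move=> pr_p zP; have Zz := Aint_prim_root zP.
have := prod_prim_root_sub 1 zP; under [RHS]eq_bigr do rewrite expr1n.
rewrite sumr_const card_ord => <-; rewrite -subn1 -prodr_const_nat big_nat.
rewrite [\prod_(1 <= i < p) (1 - _)]big_nat; apply: dvdA_prod => i /andP[i0 ip].
have zi : p.-primitive_root (z ^+ i).
  by rewrite prim_root_exp_coprime // coprime_sym prime_coprime // gtnNdvd.
have [k zk] := prim_rootP zi (prim_expr_order zP).
by rewrite dvdA_sub1C [X in (_ %| X - 1)%A]zk eqAmod_pow1 ?rpredX.
Qed.

Lemma dvdA_prim_root_prime p (z : algC) : prime p -> p.-primitive_root z ->
  (z - 1 %| p%:R)%A.
Proof.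
move=> pr_p zP; have := prod_prim_root_sub 1 zP.
under [RHS]eq_bigr do rewrite expr1n.
rewrite sumr_const card_ord => <-; rewrite big_ltn ?prime_gt1 // expr1.
apply: dvdA_mulr; first by rewrite -dvdA_sub1C dvdAA.
by apply: rpred_prod => i _; rewrite rpredB ?rpredX ?(Aint_prim_root zP).
Qed.

Section Cyclotomic.
Variables (p : nat) (zp : algC) (v : nat) (sigma : {rmorphism algC -> algC}).
Hypotheses (pr_p : prime p) (zpP : p.-primitive_root zp).
Hypotheses (vP : primitive_root_mod p v) (sig : sigma zp = zp ^+ v).

Local Notation tau := (itermor sigma).
Local Notation pi := (zp - 1).

Lemma Aint_zp : zp \in Aint. Proof. exact: Aint_prim_root zpP. Qed.
Lemma Aint_pi : pi \in Aint. Proof. by rewrite rpredB ?Aint_zp. Qed.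

Lemma prod_sub_tau y : \prod_(i < p.-1) (y - tau i zp) = \sum_(i < p) y ^+ i.
Proof.
under eq_bigr => i _ do rewrite (tau_zp pr_p zpP sig).
rewrite (big_primitive_root_mod _ (fun x : 'F_p => y - zp ^+ x) pr_p vP).
rewrite -(prod_prim_root_sub y zpP) big_mkcond /=.
rewrite (big_Fp _ _ (fun x : nat => if x != 0%N then y - zp ^+ x else 1) pr_p).
rewrite -(big_mkord xpredT (fun x => if x != 0%N then y - zp ^+ x else 1)).
rewrite big_ltn ?prime_gt0 //= mul1r big_nat [RHS]big_nat.
by apply: eq_bigr => i; case: i.
Qed.

Lemma prod_1sub_tau : \prod_(i < p.-1) (1 - tau i zp) = p%:R.
Proof.
rewrite prod_sub_tau; under eq_bigr do rewrite expr1n.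
by rewrite sumr_const card_ord.
Qed.

Lemma dvdA_pi_tau i : (pi %| tau i zp - 1)%A.
Proof. by rewrite (tau_zp pr_p zpP sig) eqAmod_pow1 ?Aint_zp. Qed.

Lemma dvdA_tau_pi i : (tau i zp - 1 %| pi)%A.
Proof.
have [k zk] := prim_rootP (prim_tau sigma zpP i) (prim_expr_order zpP).
by rewrite [X in (_ %| X - 1)%A]zk eqAmod_pow1 // Aint_aut Aint_zp.
Qed.

(** If [pi] were a unit, so would be all its conjugates, hence also their product, which is [p] up
    to sign. *)
Lemma pi_not_dvdA1 : ~~ (pi %| 1)%A.
Proof.
apply/negP=> pi1; have : (p%:R %| (1%:R : algC))%A.
  rewrite -prod_1sub_tau -[X in (_ %| X)%A](expr1n _ p.-1) -[X in _ ^+ X]card_ord.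
  rewrite -prodr_const; apply: dvdA_prod => i _.
  by rewrite dvdA_sub1C (dvdA_trans (dvdA_tau_pi i)).
rewrite -eqAmod0 (eqAmod0_nat p 1) dvdn1 => /eqP p1.
by have := prime_gt1 pr_p; rewrite p1.
Qed.

(** In the factorization of [a ^+ p - b ^+ p] the cofactor of [a - b] is congruent to
    [p * b ^+ p.-1], hence to 0, modulo [pi]. *)
Lemma eqAmod_pi_exp k a b : a \in Aint -> b \in Aint -> (0 < k)%N ->
  (a == b %[mod (pi ^+ k)%R])%A -> (a ^+ p == b ^+ p %[mod (pi ^+ k.+1)%R])%A.
Proof.
move=> Za Zb k0 ab; rewrite /eqAmod subrXX exprSr dvdA_mul //.
have ab1 : (a == b %[mod pi])%A.
  by apply: eqAmod_dvd ab; apply: (@dvdA_expW 1); rewrite ?Aint_pi.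
rewrite -eqAmod0; apply: (eqAmod_trans (y := \sum_(i < p) b ^+ p.-1)).
  rewrite /eqAmod -sumrB rpred_sum // => i _.
  have -> : b ^+ p.-1 = b ^+ (p.-1 - i) * b ^+ i.
    by rewrite -exprD; congr (_ ^+ _); have := ltn_ord i; lia.
  by apply: eqAmodM; rewrite ?rpredX // eqAmodX.
rewrite sumr_const card_ord eqAmod0 -mulr_natl dvdA_mulr ?rpredX //.
exact: dvdA_prim_root_prime.
Qed.

(** If [z != 1], then [zp] is a power of [z], so [z - 1] divides [pi], and [pi ^+ 2] would divide
    [pi]. *)
Lemma eqAmod_pi2_unity_root z : z ^+ p = 1 -> (z == 1 %[mod (pi ^+ 2)%R])%A -> z = 1.
Proof.
move=> zp1 z1; apply/eqP; apply: contraNT pi_not_dvdA1 => nz1.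
have zP := prime_prim_root pr_p zp1 nz1.
have [k zk] := prim_rootP zP (prim_expr_order zpP).
have : ((pi ^+ 2)%R %| pi)%A.
  rewrite [X in (_ %| X - 1)%A]zk; apply: dvdA_trans z1 _.
  by rewrite eqAmod_pow1 // (Aint_prim_root zP).
have pi0 : pi != 0.
  by rewrite subr_eq0 -(prim_order_dvd zpP 1) dvdn1; rewrite gtn_eqF ?prime_gt1.
case/dvdAP=> c Zc; rewrite expr2 -mulrA -{1}[pi]mulr1 => /(mulfI pi0) e.
by apply/dvdAP; exists c.
Qed.

(** The traces of [x * zp ^+ j] are rational integers divisible by [p ^ N] but bounded by
    [p.-1 * 2], so they vanish, and [trace_dual] gives [x = 0]. *)
Lemma Kp_dvdA_eq0 x N : x \in Kp zp -> x \in Aint ->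
  (forall i, `|tau i x| <= 2) -> (p.-1 * 2 < p ^ N)%N ->
  ((p%:R ^+ N)%R %| x)%A -> x = 0.
Proof.
move=> Kx Zx nx lN dx.
have p0 : p%:R != 0 :> algC by rewrite pnatr_eq0 -lt0n prime_gt0.
have T0 j : trace p sigma (x * zp ^+ j) = 0.
  have QT : trace p sigma (x * zp ^+ j) \in Crat.
    by rewrite (trace_Crat pr_p zpP vP sig) // rpredM ?rpredX ?Kp_gen.
  have dT : ((p%:R ^+ N)%R %| trace p sigma (x * zp ^+ j))%A.
    rewrite rpred_sum // => i _.
    have -> : p%:R ^+ N = tau i (p%:R ^+ N) by rewrite rmorphXn rmorph_nat.
    by apply: rmorph_dvdA; rewrite dvdA_mulr // rpredX ?Aint_zp.
  have nT : `|trace p sigma (x * zp ^+ j)| <= (p.-1 * 2)%:R.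
    apply: le_trans (ler_norm_sum _ _ _) _.
    rewrite natrM -[X in X%:R]card_ord mulr_natl -sumr_const ler_sum // => i _.
    have nz : `|tau i zp| = 1.
      exact: norm_unity_root (prime_gt0 pr_p) (prim_expr_order (prim_tau sigma zpP i)).
    by rewrite rmorphM normrM rmorphXn normrX nz expr1n mulr1.
  case/dvdAP: dT => c Zc Tc.
  have Qc : c \in Crat.
    have -> : c = trace p sigma (x * zp ^+ j) / p%:R ^+ N.
      by rewrite Tc mulrC mulKf // expf_neq0.
    by rewrite rpred_div ?rpredX ?rpred_nat.
  have /intrP[m cm] := Cint_rat_Aint Qc Zc.
  move: nT; rewrite Tc cm normrM normrX normr_nat -intr_norm -natrX.
  have [->|m0] := eqVneq m 0; first by rewrite mulr0.
  rewrite lt_geF //; apply: lt_le_trans (_ : (p ^ N)%:R <= _).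
    by rewrite ltr_nat.
  by rewrite ler_peMr ?ler0n // ler1z; lia.
have := trace_dual pr_p zpP vP sig x.
rewrite big1 => [/esym/eqP|j _]; last by rewrite T0 mul0r.
by rewrite mulf_eq0 (negPf p0) => /eqP.
Qed.

Lemma Kp_unit_eq1 w : w \in Kp zp -> w \in Aint -> (forall i, `|tau i w| = 1) ->
  (w == 1 %[mod (pi ^+ 2)%R])%A -> w = 1.
Proof.
move=> Kw Zw nw w1.
have wn n : (w ^+ (p ^ n) == 1 %[mod (pi ^+ n.+2)%R])%A.
  elim: n => [|n IH]; first by rewrite expr1.
  have := eqAmod_pi_exp (rpredX (p ^ n) Zw) (rpred1 Aint) (isT : 0 < n.+2)%N IH.
  by rewrite expr1n -exprM -expnSr.
have [n wn1] : exists n, w ^+ (p ^ n) = 1.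
  (* Since [p] divides [pi ^+ p.-1], this exponent makes the difference divisible by
     [p ^ (p.-1 * 2)], which exceeds the trace bound [p.-1 * 2]. *)
  exists (p.-1 * (p.-1 * 2))%N; apply/eqP; rewrite -subr_eq0; apply/eqP.
  apply: (@Kp_dvdA_eq0 _ (p.-1 * 2)).
  - by rewrite rpredB ?rpredX ?rpred1.
  - by rewrite rpredB ?rpredX.
  - move=> i; rewrite rmorphB rmorphXn rmorph1 (le_trans (ler_normB _ _)) //.
    by rewrite normrX nw expr1n normr1.
  - by rewrite ltn_expl // prime_gt1.
  - apply: dvdA_trans (wn _); apply: (dvdA_trans (y := pi ^+ (p.-1 * (p.-1 * 2)))).
      by rewrite exprM dvdA_exp // dvdA_prime_prim_root.
    by apply: dvdA_expW; rewrite ?Aint_pi //; lia.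
(* Descent: [w ^+ (p ^ n)] is a [p]-th root of unity congruent to 1 modulo [pi ^+ 2], hence equal to
   1. *)
elim: n wn1 => // n IH; rewrite expnSr exprM => /eqAmod_pi2_unity_root wn1.
apply: IH; apply: wn1; apply: eqAmod_dvd (wn n).
by apply: dvdA_expW; rewrite ?Aint_pi.
Qed.

End Cyclotomic.

(** * Binomial moments over a prime field *)

Lemma natr_ffact (R : pzRingType) n m :
  (n ^_ m)%:R = \prod_(i < m) (n%:R - i%:R) :> R.
Proof.
elim: m => [|m IH]; first by rewrite big_ord0.
rewrite big_ord_recr /= -IH ffactnSr natrM.
case: (leqP m n) => [mn|nm]; first by rewrite natrB.
by rewrite ffact_small // !mul0r.
Qed.

Lemma Fp_natr_eq q m n : prime q ->
  (m%:R == n%:R :> 'F_q) = (m == n %[mod q])%N.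
Proof. by move=> pr_q; rewrite -val_eqE /= !val_Fp_nat. Qed.

Lemma natr_Fp q (x : 'F_q) : x%:R = x.
Proof. exact: natr_Zp. Qed.

Lemma Fp_exp_pred q (x : 'F_q) : prime q -> x != 0 -> x ^+ q.-1 = 1.
Proof.
move=> pr_q x0; apply: (mulfI x0); rewrite mulr1 -exprS prednK ?prime_gt0 //.
by rewrite -[RHS]expf_card card_Fp.
Qed.

Lemma sum_Fp_exp_bin q e j : prime q -> (0 < e)%N -> (e + j < q.-1)%N ->
  (q %| \sum_(x : 'F_q) x ^ e * 'C(x, j))%N.
Proof.
move=> pr_q e0 ej; have jq : (j < q)%N by lia.
rewrite -[(q %| _)%N]/((_ %% q)%N == 0%N) -[X in _ == X](mod0n q) -Fp_natr_eq //.
have jf : (j`!)%:R != 0 :> 'F_q.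
  rewrite -ffactnn natr_ffact prodf_seq_neq0; apply/allP=> i _ /=.
  have ij := ltn_ord i; rewrite subr_eq0 Fp_natr_eq // !modn_small ?gtn_eqF //.
  exact: ltn_trans jq.
rewrite -(mulIr_eq0 _ (mulIf jf)) natr_sum mulr_suml.
pose P : {poly 'F_q} := 'X^e * \prod_(i < j) ('X - (i%:R)%:P).
rewrite (eq_bigr (fun x : 'F_q => P.[x])) => [|x _].
  apply/eqP/sum_Fp_poly => //.
  rewrite size_Mmonic ?monic_prod_XsubC ?monic_neq0 ?monicXn //.
  by rewrite size_polyXn -(big_mkord xpredT (fun i : nat => 'X - (i%:R)%:P)) size_prod_XsubC size_iota; lia.
rewrite -natrM -mulnA bin_ffact natrM natrX natr_Fp natr_ffact natr_Fp.
rewrite /P hornerM hornerXn horner_prod; congr (_ * _).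
by apply: eq_bigr => i _; rewrite hornerXsubC.
Qed.

(** * The residue field of [qI] and the character [chi] *)

Lemma OKP zp x : OK zp x <-> (x \in Kp zp) /\ (x \in Aint).
Proof. by split=> -[/KpP Kx Zx]; split=> //; apply/KpP. Qed.

Section OKring.
Variable zp : algC.
Lemma OK_nat n : OK zp n%:R.
Proof. by apply/OKP; rewrite !rpred_nat. Qed.
Lemma OKM x y : OK zp x -> OK zp y -> OK zp (x * y).
Proof. by move=> /OKP[Kx Zx] /OKP[Ky Zy]; apply/OKP; rewrite !rpredM. Qed.
Lemma OKD x y : OK zp x -> OK zp y -> OK zp (x + y).
Proof. by move=> /OKP[Kx Zx] /OKP[Ky Zy]; apply/OKP; rewrite !rpredD. Qed.
Lemma OKN x : OK zp x -> OK zp (- x).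
Proof. by move=> /OKP[Kx Zx]; apply/OKP; rewrite !rpredN. Qed.
Lemma OKX n x : OK zp x -> OK zp (x ^+ n).
Proof. by move=> /OKP[Kx Zx]; apply/OKP; rewrite !rpredX. Qed.
End OKring.

Section ResidueField.
Variables (p : nat) (zp : algC) (q : nat) (qI : algC -> Prop).
Hypotheses (pr_p : prime p) (zpP : p.-primitive_root zp).
Hypotheses (pr_q : prime q) (qp : q <> p).
Hypotheses (qI_prime : prime_ideal (OK zp) qI) (qIq : qI q%:R).
Hypothesis qI_norm : ideal_norm (OK zp) qI q.

Lemma qI_OK x : qI x -> OK zp x.
Proof. by case: qI_prime => -[[h _] _] _; apply: h. Qed.
Lemma qI0 : qI 0.
Proof. by case: qI_prime => -[[_ [h _]] _] _. Qed.
Lemma qID x y : qI x -> qI y -> qI (x + y).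
Proof. by case: qI_prime => -[[_ [_ [h _]]] _] _; apply: h. Qed.
Lemma qIMl r x : OK zp r -> qI x -> qI (r * x).
Proof. by case: qI_prime => -[[_ [_ [_ h]]] _] _; apply: h. Qed.
Lemma qIMr r x : OK zp r -> qI x -> qI (x * r).
Proof. by rewrite mulrC; apply: qIMl. Qed.
Lemma qIN x : qI x -> qI (- x).
Proof. by rewrite -mulN1r; apply/qIMl/OKN/(OK_nat _ 1). Qed.
Lemma qIB x y : qI x -> qI y -> qI (x - y).
Proof. by move=> Ix /qIN; apply: qID. Qed.
Lemma qI_sum (I : Type) (r : seq I) (P : pred I) F :
  (forall i, P i -> qI (F i)) -> qI (\sum_(i <- r | P i) F i).
Proof. by move=> H; elim/big_ind: _ => //; [apply: qI0|apply: qID]. Qed.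
Lemma qI_trans y x z : qI (x - y) -> qI (y - z) -> qI (x - z).
Proof. by move=> /qID h /h; rewrite addrA subrK. Qed.
Lemma qI_sym x y : qI (x - y) -> qI (y - x).
Proof. by move/qIN; rewrite opprB. Qed.

Lemma qI_congM a b c d : OK zp b -> OK zp c ->
  qI (a - b) -> qI (c - d) -> qI (a * c - b * d).
Proof.
move=> Ob Oc ab cd; rewrite (_ : _ - _ = (a - b) * c + b * (c - d)); last by ring.
by apply: qID; [apply: qIMr|apply: qIMl].
Qed.

Lemma qI_congX n a b : OK zp a -> OK zp b -> qI (a - b) -> qI (a ^+ n - b ^+ n).
Proof.
move=> Oa Ob ab; elim: n => [|n IH]; first by rewrite !expr0 subrr; apply: qI0.
by rewrite !exprS; apply: qI_congM => //; apply: OKX.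
Qed.

Lemma qI_dvdn n : qI n%:R -> (q %| n)%N.
Proof.
move=> In; case: (boolP (q %| n)%N) => //; rewrite -prime_coprime // coprime_sym.
have [->|n0] := posnP n; first by rewrite /coprime gcd0n => /eqP q1; move: (prime_gt1 pr_q); rewrite q1.
case: (egcdnP q n0) => a b e _ /eqP g1; case: qI_prime => _ [I1 _]; case: I1.
have -> : 1 = a%:R * n%:R - b%:R * q%:R :> algC.
  by rewrite -!natrM e -/(gcdn n q) g1 natrD addrAC subrr add0r.
by apply: qIB; apply: qIMl => //; apply: OK_nat.
Qed.

Lemma qI_Fp m n : m%:R = n%:R :> 'F_q -> qI (m%:R - n%:R).
Proof.
wlog nm : m n / (n <= m)%N.
  by case: (leqP n m) => [|/ltnW] h H e; [apply: H|apply/qI_sym/H].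
move/eqP; rewrite Fp_natr_eq // eqn_mod_dvd // => /dvdnP[k e].
by rewrite -natrB // e natrM; apply/qIMl/qIq/OK_nat.
Qed.

Lemma Fp_qI m n : qI (m%:R - n%:R) -> m%:R = n%:R :> 'F_q.
Proof.
wlog nm : m n / (n <= m)%N.
  by case: (leqP n m) => [|/ltnW] h H e; [apply: H|apply/esym/H/qI_sym].
by rewrite -natrB // => /qI_dvdn; rewrite -eqn_mod_dvd // -Fp_natr_eq // => /eqP.
Qed.

(** The integers below [q] are pairwise incongruent modulo [qI], and there are only [q] classes, so
    they represent all of them. *)
Lemma qI_residue x : OK zp x -> exists n : nat, qI (x - n%:R).
Proof.
case: qI_norm => R [OR [Rinj Rsurj]] Ox.
have /fin_all_exists[f fP] : forall i : 'I_q, exists j : 'I_q, qI (i%:R - R j).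
  move=> i; have [j jq Ij] := Rsurj _ (OK_nat zp i).
  by exists (Ordinal jq).
have finj : injective f.
  move=> i j e; apply: val_inj => /=.
  have : qI (i%:R - j%:R) by apply: qI_trans (fP i) _; rewrite e; apply/qI_sym/fP.
  by move/Fp_qI/eqP; rewrite Fp_natr_eq // !modn_small // => /eqP.
have [k kq Ik] := Rsurj _ Ox.
exists (invF finj (Ordinal kq)).
by apply: qI_trans Ik _; apply: qI_sym; have := fP (invF finj (Ordinal kq)); rewrite f_invF.
Qed.

Lemma OK_zp : OK zp zp.
Proof. by apply/OKP; rewrite Kp_gen (Aint_prim_root zpP). Qed.

(* The residue class of zp is represented by a multiple of p, so that the
   conjugates of zp - c become pairwise comaximal. *)
Lemma qI_zp_residue : exists c : nat,
  [/\ qI (zp - c%:R), p.-primitive_root (c%:R : 'F_q) & (p %| c)%N].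
Proof.
have [c0 Ic0] := qI_residue OK_zp.
have co : coprime p q by rewrite prime_coprime // dvdn_prime2 //; apply/eqP/nesym.
pose c := chinese p q 0 c0; exists c.
have Ic : qI (zp - c%:R).
  apply: qI_trans Ic0 _; apply: qI_Fp; apply/eqP.
  by rewrite Fp_natr_eq // eq_sym chinese_modr.
have cp : (c%:R : 'F_q) ^+ p = 1.
  rewrite -natrX -[1]/(1%:R); apply: Fp_qI; rewrite natrX.
  by rewrite -[1%:R](prim_expr_order zpP); apply/qI_sym/qI_congX/Ic/OK_nat/OK_zp.
split=> //; last by rewrite /dvdn chinese_modl // mod0n.
apply: prime_prim_root => //; apply: contra_not_neq qp => c1.
(* If [c] were 1 modulo [q], then [p], a multiple of [1 - zp], would lie in [qI], forcing
   [q = p]. *)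
have I1 : qI (zp - 1) := qI_trans Ic (qI_Fp (c1 : c%:R = 1%:R)).
apply/eqP; rewrite -dvdn_prime2 //; apply: qI_dvdn.
have := prod_prim_root_sub 1 zpP; under [RHS]eq_bigr do rewrite expr1n.
rewrite sumr_const card_ord => <-; rewrite big_ltn ?prime_gt1 // expr1.
apply: qIMr; last by apply/qI_sym.
by apply: big_ind => [||i _]; [apply: (OK_nat _ 1)|apply: OKM|
  apply: OKD; [apply: (OK_nat _ 1)|apply/OKN/OKX/OK_zp]].
Qed.

Local Notation k := ((q - 1) %/ p)%N.
Local Notation X x := (chi p qI q (nat_of_ord (x : 'F_q))).

(** The residue of [zp] has order [p] in the multiplicative group of ['F_q], so [p] divides
    [q - 1]. *)
Lemma mul_k_p : (k * p)%N = q.-1.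
Proof.
have [c [_ cP _]] := qI_zp_residue.
rewrite subn1 divnK // (prim_order_dvd cP) Fp_exp_pred //.
exact: prim_root_neq0 cP.
Qed.

Lemma k_gt0 : (0 < k)%N.
Proof. by have := mul_k_p; have := prime_gt1 pr_q; case: k => //; lia. Qed.

(** Reduction sends [zp] to [c], which still has order [p]. Identities between values of [chi] can
    therefore be checked modulo [qI]. *)
Lemma qI_unity_root_inj w z : w ^+ p = 1 -> z ^+ p = 1 -> qI (w - z) -> w = z.
Proof.
move=> /(prim_rootP zpP)[i ->] /(prim_rootP zpP)[j ->] Iij.
have [c [Ic cP _]] := qI_zp_residue.
have Ii i' : qI (zp ^+ i' - c%:R ^+ i') by apply: qI_congX Ic; [apply: OK_zp|apply: OK_nat].
have : qI ((c ^ i)%:R - (c ^ j)%:R).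
  by rewrite !natrX; apply: qI_trans (Ii j); apply: qI_trans Iij; apply/qI_sym/Ii.
move/Fp_qI/eqP; rewrite !natrX (eq_prim_root_expr cP) => ij.
by apply/eqP; rewrite (eq_prim_root_expr zpP).
Qed.

(** The choice by [epsilon] has a witness: [x ^+ k] is a [p]-th root of unity in ['F_q], so a power
    of [c], and lifts to the same power of [zp]. *)
Lemma power_residueP (x : 'F_q) (w := power_residue p qI q x%:R) : x != 0 ->
  w ^+ p = 1 /\ qI (x%:R ^+ k - w).
Proof.
move=> x0; apply: (epsilon_spec (inhabits 0) (fun w => w ^+ p = 1 /\ _)).
have [c [Ic cP _]] := qI_zp_residue.
have [j xj] : {j : 'I_p | x ^+ k = c%:R ^+ j}.
  by apply: (prim_rootP cP); rewrite -exprM mul_k_p Fp_exp_pred.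
exists (zp ^+ j); split; first by rewrite exprAC (prim_expr_order zpP) expr1n.
apply: (@qI_trans (c%:R ^+ j)); last first.
  by apply/qI_sym/qI_congX/Ic/OK_nat/OK_zp.
by rewrite -!natrX; apply: qI_Fp; rewrite !natrX natr_Fp.
Qed.

Lemma chi0 : X 0 = 0.
Proof. by rewrite /chi mod0n eqxx. Qed.

Lemma chiE x : x != 0 -> X x = (power_residue p qI q x%:R)^-1.
Proof.
move=> x0; have /negPf nx0 : (x : nat) != 0%N by [].
by rewrite /chi modn_small ?ltn_Fp // nx0.
Qed.

Lemma chi_unity_root x : x != 0 -> X x ^+ p = 1.
Proof.
move=> x0; rewrite chiE //.
by have [w1 _] := power_residueP x0; rewrite exprVn w1 invr1.
Qed.

Lemma OK_unity_root w : w ^+ p = 1 -> OK zp w.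
Proof. by move=> /(prim_rootP zpP)[i ->]; apply/OKX/OK_zp. Qed.

Lemma OK_chi x : OK zp (X x).
Proof.
have [->|/chi_unity_root] := eqVneq x 0; first by rewrite chi0; apply: (OK_nat _ 0).
exact: OK_unity_root.
Qed.

Lemma chi_cong x : qI (X x - x%:R ^+ (k * p.-1)).
Proof.
have p1 : (0 < p.-1)%N by have := prime_gt1 pr_p; lia.
have [->|x0] := eqVneq x 0.
  by rewrite chi0 expr0n eqn0Ngt muln_gt0 k_gt0 p1 subrr; apply: qI0.
have [w1 Iw] := power_residueP x0.
rewrite chiE // exprM; set w := power_residue _ _ _ _ in w1 Iw *.
have -> : w^-1 = w ^+ p.-1.
  have w0 : w != 0 by apply: contra_eq_neq w1 => ->; rewrite expr0n eqn0Ngt prime_gt0 // eq_sym oner_eq0.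
  by apply: (mulfI w0); rewrite divff // -exprS prednK ?prime_gt0.
apply/qI_sym/qI_congX/Iw; last exact: OK_unity_root.
exact/OKX/OK_nat.
Qed.

Lemma chiM x y : X (x * y) = X x * X y.
Proof.
have [->|x0] := eqVneq x 0; first by rewrite mul0r chi0 mul0r.
have [->|y0] := eqVneq y 0; first by rewrite mulr0 chi0 mulr0.
apply: qI_unity_root_inj; rewrite ?exprMn ?chi_unity_root ?mulf_neq0 ?mulr1 //.
apply: qI_trans (chi_cong _) _; apply: qI_sym.
apply: (@qI_trans (x%:R ^+ (k * p.-1) * y%:R ^+ (k * p.-1))).
  apply: qI_congM; rewrite ?OK_chi; first exact/OKX/OK_nat.
  - exact: OK_chi.
  - exact: chi_cong.
  - exact: chi_cong.
by rewrite -!natrX -natrM; apply: qI_Fp; rewrite natrM !natrX !natr_Fp exprMn.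
Qed.

Lemma chi_nontrivial : exists2 a : 'F_q, a != 0 & X a != 1.
Proof.
have kq : (0 < k < q.-1)%N.
  by rewrite k_gt0 -mul_k_p ltn_Pmulr ?k_gt0 ?prime_gt1.
have [a a0 ak] := Fp_exp_neq1 pr_q kq; exists a => //.
apply: contra ak => /eqP a1; have := chi_cong a.
rewrite a1 -natrX -[1]/(1%:R) => /Fp_qI; rewrite natrX natr_Fp => e.
have := Fp_exp_pred pr_q a0; rewrite -mul_k_p -{2}(prednK (prime_gt0 pr_p)).
by rewrite mulnS exprD -e mulr1 => ->.
Qed.

(** Modulo [qI] the character is [x] to the power [- k]; the exponent is shifted by [q.-1] to be
    positive, so that the congruence also holds at [x = 0]. *)
Lemma chiX_cong t x : (0 < t < p)%N ->
  qI (X x ^+ t - (x ^ (q.-1 - k * t))%:R).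
Proof.
case/andP=> t0 tp; have kt : (k * t < q.-1)%N by rewrite -mul_k_p ltn_mul2l k_gt0.
apply: (@qI_trans ((x%:R ^+ (k * p.-1)) ^+ t)).
  by apply: qI_congX (chi_cong x); [apply: OK_chi|apply/OKX/OK_nat].
rewrite -exprM -natrX; apply: qI_Fp; rewrite !natrX !natr_Fp.
have [->|x0] := eqVneq x 0.
  rewrite !expr0n !eqn0Ngt !muln_gt0 k_gt0 t0 subn_gt0 kt.
  by have := prime_gt1 pr_p; case: (p) => [|[]].
apply: (mulIf (expf_neq0 (k * t) x0)); rewrite -!exprD subnK ?(ltnW kt) //.
rewrite (_ : (_ + _)%N = (q.-1 * t)%N).
  by rewrite exprM Fp_exp_pred // expr1n.
by rewrite -mulnDl addnC -mulnS prednK ?prime_gt0 // mul_k_p.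
Qed.
End ResidueField.

(** * Gauss sums of a multiplicative character *)

Section GaussSum.
Variables (q : nat) (zq : algC) (X : 'F_q -> algC).
Hypotheses (pr_q : prime q) (zqP : q.-primitive_root zq).
Hypotheses (X0 : X 0 = 0) (XM : forall x y, X (x * y) = X x * X y).

Definition gsum : algC := \sum_x X x * zq ^+ x.

Lemma exp_FpD (x y : 'F_q) : zq ^+ (x + y)%R = zq ^+ x * zq ^+ y.
Proof. by rewrite -{1}[x]natr_Fp -{1}[y]natr_Fp -natrD exp_Fp_nat // exprD. Qed.

Lemma exp_FpM (x y : 'F_q) : zq ^+ (x * y)%R = (zq ^+ x) ^+ y.
Proof. by rewrite -{1}[x]natr_Fp -{1}[y]natr_Fp -natrM exp_Fp_nat // exprM. Qed.

Lemma sum_exp_Fp (u : 'F_q) :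
  \sum_(y : 'F_q) zq ^+ (u * y)%R = if u == 0 then q%:R else 0.
Proof.
case: eqP => [->|/eqP u0].
  by under eq_bigr do rewrite mul0r expr0; rewrite sumr_const card_Fp.
transitivity (\sum_(y : 'F_q) zq ^+ y).
  by rewrite [RHS](reindex_inj (mulfI u0)).
rewrite (big_Fp _ _ (fun i => zq ^+ i) pr_q) sum_exp_eq1 ?(prim_expr_order zqP) //.
by rewrite -(prim_order_dvd zqP 1) dvdn1 gtn_eqF ?prime_gt1.
Qed.

(** Replacing [zq] by [zq ^+ c] divides the sum by [X c], invisible to the [n]-th power. Averaging
    over [c != 0] leaves only the sums of [(zq ^+ c) ^+ j], which are rational. *)
Lemma gsum_exp_Kp zp n : (forall x, X x \in Kp zp) ->
  (forall x, x != 0 -> X x ^+ n = 1) -> (0 < n)%N -> gsum ^+ n \in Kp zp.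
Proof.
move=> KX Xn n0.
pose P := \sum_x X x *: 'X^(nat_of_ord x).
have KP : P ^+ n \is a polyOver (Kp zp).
  by rewrite rpredX // rpred_sum // => x _; rewrite polyOverZ // rpredX // polyOverX.
have Pe (c : 'F_q) : c != 0 -> P.[zq ^+ c] ^+ n = gsum ^+ n.
  move=> c0; rewrite -[LHS]mul1r -(Xn _ c0) -exprMn; congr (_ ^+ n).
  rewrite horner_sum mulr_sumr /gsum [RHS](reindex_inj (mulfI c0)) /=.
  by apply: eq_bigr => x _; rewrite hornerZ hornerXn XM exp_FpM mulrA.
have q10 : (q.-1)%:R != 0 :> algC.
  by rewrite pnatr_eq0; have := prime_gt1 pr_q; lia.
have -> : gsum ^+ n = (q.-1)%:R^-1 * \sum_(c : 'F_q | c != 0) (P ^+ n).[zq ^+ c].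
  under eq_bigr => c c0 do rewrite horner_exp Pe //.
  rewrite (eq_bigl [in predC1 (0 : 'F_q)]) // sumr_const cardC1 card_Fp //.
  by rewrite -[gsum ^+ n *+ _]mulr_natl mulKf.
apply: rpredM; first by rewrite Kp_Crat ?rpredV ?rpred_nat.
under eq_bigr do rewrite horner_coef.
rewrite exchange_big rpred_sum //= => j _; rewrite -mulr_sumr.
apply: rpredM; first exact: (polyOverP KP).
apply: Kp_Crat.
have -> : \sum_(c : 'F_q | c != 0) (zq ^+ c) ^+ j =
   \sum_(c : 'F_q) zq ^+ (j%:R * c)%R - 1.
  rewrite [X in _ = X - 1](bigD1 0) // mulr0 expr0 addrAC subrr add0r.
  by apply: eq_bigr => c _; rewrite exp_FpM exp_Fp_nat // exprAC.
by rewrite sum_exp_Fp rpredB ?rpred1 //; case: eqP; rewrite ?rpred_nat ?rpred0.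
Qed.

Hypotheses (Xnorm : forall x, x != 0 -> X x * (X x)^* = 1).
Hypothesis (Xnt : exists2 a, a != 0 & X a != 1).

Lemma char1 : X 1 = 1.
Proof.
have X10 : X 1 != 0.
  apply/eqP=> X10; have := Xnorm (oner_neq0 _).
  by rewrite X10 mul0r => /eqP; rewrite eq_sym oner_eq0.
by apply: (mulfI X10); rewrite -XM !mulr1.
Qed.

Lemma sum_char : \sum_x X x = 0.
Proof.
have [a a0 Xa] := Xnt.
have : X a * \sum_x X x = \sum_x X x.
  rewrite mulr_sumr [RHS](reindex_inj (mulfI a0)) /=.
  by apply: eq_bigr => x _; rewrite XM.
move/eqP; rewrite -subr_eq0 -{2}[\sum_x _]mul1r -mulrBl mulf_eq0 subr_eq0.
by rewrite (negPf Xa) => /eqP.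
Qed.

Lemma gsum_norm : gsum * gsum^* = q%:R.
Proof.
have e1 (x : 'F_q) : zq ^+ x * (zq ^+ x)^* = 1.
  rewrite (@conj_unity_root q) ?prime_gt0 ?divff ?expf_neq0 ?(prim_root_neq0 zqP) //.
  by rewrite exprAC (prim_expr_order zqP) expr1n.
rewrite {2}/gsum rmorph_sum mulr_sumr (bigD1 0) //= X0 mul0r rmorph0 mulr0 add0r.
(* The first summation variable is written [z * y]. Summing over [y != 0] then yields [q - 1] for
   [z = 1] and [-1] for every other [z]. *)
transitivity (\sum_(y : 'F_q | y != 0) \sum_(z : 'F_q) X z * zq ^+ ((z - 1) * y)%R).
  apply: eq_bigr => y y0; rewrite /gsum mulr_suml (reindex_inj (mulIf y0)).
  have -> : (X y * zq ^+ y)^* = (X y)^* * (zq ^+ y)^* by rewrite rmorphM.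
  apply: eq_bigr => z _; rewrite XM mulrBl mul1r.
  rewrite -[RHS]mulr1 -(Xnorm y0) -[z * y](subrK y) exp_FpD.
  by rewrite -[RHS]mulr1 -[in RHS](e1 y) addrK; ring.
rewrite exchange_big /=.
transitivity (\sum_z (X z * (if z == 1 then q%:R else 0) - X z)).
  apply: eq_bigr => z _; rewrite -mulr_sumr -subr_eq0 -sum_exp_Fp.
  by rewrite [in RHS](bigD1 0) // mulr0 expr0 mulrDr mulr1 addrAC subrr add0r.
rewrite sumrB sum_char subr0 (bigD1 1) // eqxx char1 mul1r big1 => [|z /negPf->].
  exact: addr0.
by rewrite mulr0.
Qed.
End GaussSum.

(** * Divisibility of Gauss sums *)

Section Stickelberger.
Variables (p : nat) (zp : algC) (q : nat) (qI : algC -> Prop).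
Hypotheses (pr_p : prime p) (zpP : p.-primitive_root zp).
Hypotheses (pr_q : prime q) (qp : q <> p).
Hypotheses (qI_prime : prime_ideal (OK zp) qI) (qIq : qI q%:R).
Hypothesis qI_norm : ideal_norm (OK zp) qI q.

Local Notation k := ((q - 1) %/ p)%N.
Local Notation X x := (chi p qI q (nat_of_ord (x : 'F_q))).

(** Modulo [qI] this is the binomial moment with exponent [q.-1 - k * t]; the bound on [j] is what
    makes [sum_Fp_exp_bin] apply. *)
Lemma chi_moment t j : (0 < t < p)%N -> (j < k * t)%N ->
  qI (\sum_(x : 'F_q) X x ^+ t * 'C(x, j)%:R).
Proof.
move=> tp jk; have kp := mul_k_p pr_p zpP pr_q qp qI_prime qIq qI_norm.
have k0 := k_gt0 pr_p zpP pr_q qp qI_prime qIq qI_norm.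
have kt : (k * t < q.-1)%N.
  by rewrite -kp ltn_mul2l k0; case/andP: tp.
have /dvdnP[d dE] := @sum_Fp_exp_bin q (q.-1 - k * t) j pr_q ltac:(lia) ltac:(lia).
rewrite -[\sum_x _](subrK (d * q)%:R); apply: (qID qI_prime); last first.
  by rewrite natrM; apply/(qIMl qI_prime)/qIq/OK_nat.
rewrite -dE natr_sum -sumrB; apply: (qI_sum qI_prime) => x _.
rewrite natrM -mulrBl; apply: (qIMr qI_prime); first exact: OK_nat.
exact: (chiX_cong pr_p zpP pr_q qp qI_prime qIq qI_norm x tp).
Qed.

Lemma gauss_lower_bound t (gam A s : algC) : q.-primitive_root s ->
  gam \in Aint -> gam ^+ (p ^ 2) = A -> (forall x, qI x -> (A %| x ^+ p)%A) ->
  (0 < t < p)%N -> (gam ^+ t %| \sum_(x : 'F_q) X x ^+ t * s ^+ x)%A.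
Proof.
move=> sP Zg gA AqI tp.
have kp := mul_k_p pr_p zpP pr_q qp qI_prime qIq qI_norm.
have Zw : s - 1 \in Aint by rewrite rpredB // (Aint_prim_root sP).
have p0 := prime_gt0 pr_p.
(* In [p ^ 2]-th powers: [A] divides [q ^ p], and [q] divides [(s - 1) ^+ q.-1] with
   [q.-1 = k * p]. *)
have gw : (gam %| (s - 1) ^+ k)%A.
  apply: (@dvdA_exp_root (p ^ 2)); rewrite ?expn_gt0 ?p0 //.
  rewrite gA; apply: (dvdA_trans (AqI _ qIq)).
  by rewrite -exprM expnS expn1 mulnA kp exprM dvdA_exp // dvdA_prime_prim_root.
have gI x : qI x -> (gam ^+ t %| x)%A.
  move=> Ix; apply: (dvdA_trans (y := gam ^+ p)).
    by apply: dvdA_expW => //; case/andP: tp => _ /ltnW.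
  by apply: (@dvdA_exp_root p) => //; rewrite -exprM -[(p * p)%N]/(p ^ 2)%N gA AqI.
(* The binomial expansion is padded with zero terms up to [q], making the range independent of [x]
   so that the sums can be exchanged. *)
have sE (x : 'F_q) : s ^+ x = \sum_(j < q) (s - 1) ^+ j * 'C(x, j)%:R.
  rewrite -{1}[s](subrK 1) addrC exprDn.
  rewrite -(big_mkord xpredT (fun j => (s - 1) ^+ j * 'C(x, j)%:R)).
  rewrite (@big_cat_nat _ _ _ x.+1) ?ltn_Fp //= [Y in _ = _ + Y]big_nat_cond.
  rewrite [Y in _ = _ + Y]big1 ?addr0 => [|j /andP[/andP[xj _] _]].
    by rewrite big_mkord; apply: eq_bigr => j _; rewrite expr1n mul1r mulr_natr.
  by rewrite bin_small // mulr0.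
under eq_bigr => x _ do rewrite sE mulr_sumr.
rewrite exchange_big rpred_sum //= => j _.
under eq_bigr => x _ do rewrite mulrCA.
rewrite -mulr_sumr; case: (ltnP j (k * t)) => jk.
  apply: dvdA_mull; last exact: rpredX.
  by apply: gI; apply: chi_moment.
apply: dvdA_mulr.
  apply: (dvdA_trans (y := (s - 1) ^+ (k * t))); first by rewrite exprM dvdA_exp.
  exact: dvdA_expW.
rewrite rpred_sum // => x _; rewrite rpredM ?rpredX ?rpred_nat //.
by have /OKP[] := OK_chi pr_p zpP pr_q qp qI_prime qIq qI_norm x.
Qed.
End Stickelberger.

(* Pairwise comaximality makes the cofactors generate the unit ideal. *)
Lemma dvdA_cofactors (I : eqType) (r : seq I) (y : I -> algC) (e x : algC) :
  uniq r -> r != [::] -> (forall i, y i \in Aint) -> x \in Aint ->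
  (forall i j, i \in r -> j \in r -> i != j -> comaximal (y i) (y j)) ->
  (forall j, j \in r -> (e %| x * \prod_(i <- r | i != j) y i)%A) -> (e %| x)%A.
Proof.
move=> + + Zy; elim: r x => [//|a r IH] x /= /andP[ar ur] _ Zx co H.
have Ha : (e %| x * \prod_(i <- r) y i)%A.
  have := H a (mem_head _ _); rewrite big_cons eqxx /= big_seq_cond.
  rewrite (eq_bigl [in r]) -?big_seq // => i.
  by apply: andb_idr; apply: contraTneq => ->.
case: (eqVneq r [::]) => [r0|r0]; first by move: Ha; rewrite r0 big_nil mulr1.
have Hy : (e %| x * y a)%A.
  apply: IH => //; first exact: rpredM.
    by move=> i j ir jr; apply: co; rewrite inE ?ir ?jr orbT.
  move=> j jr; have := H j; rewrite inE jr orbT big_cons => /(_ isT).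
  by rewrite (_ : a != j) ?mulrA //; apply: contraNneq ar => ->.
have [|s [t [Zs Zt st]]] := @comaximal_prod _ r y (y a) (Zy a) Zy.
  move=> i ir; apply: co; rewrite ?mem_head ?inE ?ir ?orbT //.
  by apply: contraNneq ar => ->.
rewrite -[x]mulr1 -st mulrDr; apply: rpredD.
  by rewrite mulrCA; apply: dvdA_mull.
by rewrite mulrCA; apply: dvdA_mull.
Qed.

(** * Ideal powers, conjugates of [A] and the norm of [A] *)

Lemma dvdA_ipow_expn zp qI n x : qI x -> (forall y, qI y -> OK zp y) ->
  ipow (OK zp) qI n (x ^+ n).
Proof.
move=> Ix IO; elim: n => [|n IH]; first exact: (OK_nat zp 1).
exists [:: (x, x ^+ n)]; split; last by rewrite big_seq1 exprS.
by move=> ab; rewrite inE => /eqP->.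
Qed.

Lemma in_pi_pow_dvdA zp n x : zp \in Aint -> in_pi_pow zp n x ->
  (((zp - 1) ^+ n)%R %| x)%A.
Proof.
move=> Zz; elim: n x => [|n IH] x.
  by move=> /OKP[_ Zx]; apply/dvdAP; exists x; rewrite ?mul1r.
case=> s [sP ->]; rewrite big_seq rpred_sum // => ab /sP[[r [/OKP[_ Zr] ->]] /IH].
rewrite exprS => h; apply: dvdA_mul => //.
by apply: dvdA_mulr; rewrite ?dvdAA.
Qed.

Lemma Aint_prim_rootV n (z : algC) : n.-primitive_root z -> z^-1 \in Aint.
Proof.
move=> zP; apply/(Aint_unity_root (prim_order_gt0 zP))/unity_rootP.
by rewrite exprVn (prim_expr_order zP) invr1.
Qed.

(** The expression of [inKp] as a function of the root: the conjugates of [ratpoly c zp] are its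
    values at the other powers of [zp]. *)
Definition ratpoly (c : seq rat) (z : algC) : algC :=
  \sum_(i < size c) ratr c`_i * z ^+ i.

Lemma rmorph_ratpoly (f : {rmorphism algC -> algC}) c z :
  f (ratpoly c z) = ratpoly c (f z).
Proof.
rewrite rmorph_sum; apply: eq_bigr => i _.
by rewrite rmorphM rmorphXn /= fmorph_rat.
Qed.

Section Conjugates.
Variables (p : nat) (zp : algC) (v : nat) (sigma : {rmorphism algC -> algC}).
Hypotheses (pr_p : prime p) (zpP : p.-primitive_root zp).
Hypotheses (vP : primitive_root_mod p v) (sig : sigma zp = zp ^+ v).
Variables (q : nat) (qI : algC -> Prop).
Hypotheses (pr_q : prime q) (qp : q <> p).
Hypotheses (qI_prime : prime_ideal (OK zp) qI) (qIq : qI q%:R).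
Hypothesis qI_norm : ideal_norm (OK zp) qI q.
Variable A : algC.
Hypotheses (OA : OK zp A) (AqI : ideal_eq (pideal (OK zp) A) (ipow (OK zp) qI p)).

Local Notation tau := (itermor sigma).

Lemma tau_zp_inj i j : (i < p.-1)%N -> (j < p.-1)%N ->
  tau i zp = tau j zp -> i = j.
Proof.
move=> ip jp; rewrite !(tau_zp pr_p zpP sig) => /eqP.
rewrite (eq_prim_root_expr zpP) !modn_small ?ltn_Fp // => /eqP/val_inj.
exact: (primitive_root_mod_exp_inj pr_p vP).
Qed.

(** The generated ideal contains the difference of the two conjugates of [zp], which divides [p]. So
    it contains [c], then [tau i zp], which is a unit. *)
Lemma comaximal_tau_sub c i j : (p %| c)%N -> (i < p.-1)%N -> (j < p.-1)%N ->
  i != j -> comaximal (tau i zp - c%:R) (tau j zp - c%:R).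
Proof.
move=> /dvdnP[d ->] ip jp ij.
have wi := prim_tau sigma zpP i; have wj := prim_tau sigma zpP j.
have zi0 := prim_root_neq0 wi; have zj0 := prim_root_neq0 wj.
have wP : p.-primitive_root (tau i zp / tau j zp).
  apply: prime_prim_root => //.
    by rewrite exprMn exprVn (prim_expr_order wi) (prim_expr_order wj) divr1.
  apply: contra ij => /eqP e; apply/eqP/tau_zp_inj => //.
  by rewrite -[LHS](divfK zj0) e mul1r.
have /dvdAP[s Zs ps] := dvdA_prim_root_prime pr_p wP.
set zi := tau i zp in wi zi0 wP s Zs ps *; set zj := tau j zp in wj zj0 wP s Zs ps *.
have Zi : zi \in Aint := Aint_prim_root wi.
have Zj' : zj^-1 \in Aint := Aint_prim_rootV wj.
have Zi' : zi^-1 \in Aint := Aint_prim_rootV wi.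
exists (zi^-1 * (1 + d%:R * s * zj^-1)), (- (zi^-1 * d%:R * s * zj^-1)); split.
- by rewrite !(rpredM, rpredD, rpred1, rpred_nat).
- by rewrite rpredN !(rpredM, rpred_nat).
- have {ps} ps : p%:R * zj = (zi - zj) * s by rewrite ps; field.
  rewrite natrM.
  rewrite (_ : _ + _ = zi^-1 * (zi - d%:R * p%:R + d%:R * ((zi - zj) * s) * zj^-1)); last by ring.
  by rewrite -ps mulrA mulfK // subrK mulVf.
Qed.

Lemma trace_int x : OK zp x -> exists n : int, trace p sigma x = n%:~R.
Proof.
move=> /OKP[Kx Zx]; apply/intrP/Cint_rat_Aint.
  exact: (trace_Crat pr_p zpP vP sig).
by rewrite rpred_sum // => i _; rewrite Aint_aut.
Qed.

Lemma OK_intr (n : int) : OK zp n%:~R.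
Proof. by apply/OKP; rewrite !rpred_int. Qed.

Lemma qI_intr (n : int) : qI n%:~R -> (q%:R %| (n%:~R : algC))%A.
Proof.
have pos m : qI m%:R -> (q%:R %| (m%:R : algC))%A.
  move/(qI_dvdn pr_q qI_prime qIq)/dvdnP=> [d ->].
  by rewrite natrM dvdA_mull ?dvdAA ?rpred_nat.
case: n => n; first exact: pos.
rewrite NegzE rmorphN rpredN => /(qIN qI_prime); rewrite opprK; exact: pos.
Qed.

(* Traces expand p x over the powers of zp with integer coefficients, which
   avoids knowing that the ring of integers is Z[zp]. *)
Lemma qI_gen c x : qI (zp - c%:R) -> qI x -> exists s t,
  [/\ s \in Aint, t \in Aint & p%:R * x = (zp - c%:R) * s + q%:R * t].
Proof.
move=> Ic Ix; have Ox := qI_OK qI_prime Ix.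
have OT j : OK zp (x * zp ^+ j) by apply/OKM/OKX/(OK_zp zpP).
have Ozc : OK zp (zp - c%:R) := qI_OK qI_prime Ic.
pose z' := zp ^+ p.-1; have Oz' : OK zp z' by apply/OKX/(OK_zp zpP).
have zV : zp^-1 = z'.
  apply: (mulfI (prim_root_neq0 zpP)); rewrite divff ?(prim_root_neq0 zpP) //.
  by rewrite -exprS prednK ?prime_gt0 // (prim_expr_order zpP).
have /(@fin_all_exists _ _ (fun j n => _ = n%:~R))[T TE] : forall j : 'I_p,
    exists n : int, trace p sigma (x * zp ^+ j) = n%:~R.
  by move=> j; apply: trace_int.
(* [N] is the trace expansion of [p * x] with [zp] replaced by [c], so it agrees with [p * x] modulo
   [zp - c], lies in [qI], and is a multiple of [q]. *)
pose N : int := \sum_j T j * (c ^ (p.-1 * j))%:Z.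
have px : p%:R * x = \sum_(j < p) (T j)%:~R * z' ^+ j.
  by rewrite -(trace_dual pr_p zpP vP sig) zV; apply: eq_bigr => j _; rewrite TE.
have [s Zs sE] : exists2 s, s \in Aint & p%:R * x - N%:~R = (zp - c%:R) * s.
  apply/dvdAP; rewrite px rmorph_sum -sumrB rpred_sum // => j _.
  rewrite rmorphM -mulrBr; apply: dvdA_mull; last by rewrite rpred_int.
  rewrite /= -[((c ^ _)%:Z)%:~R]/((c ^ _)%:R) natrX -exprM subrXX dvdA_mulr ?dvdAA //.
  rewrite rpred_sum // => i _; rewrite rpredM ?rpredX ?rpred_nat //.
  exact: Aint_prim_root zpP.
have IN : qI N%:~R.
  rewrite (_ : N%:~R = p%:R * x - (p%:R * x - N%:~R)); last by ring.
  apply: (qIB qI_prime); first by apply: (qIMl qI_prime); [apply: OK_nat|].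
  rewrite px rmorph_sum -sumrB; apply: (qI_sum qI_prime) => j _.
  rewrite rmorphM -mulrBr; apply: (qIMl qI_prime); first exact: OK_intr.
  rewrite /= -[((c ^ _)%:Z)%:~R]/((c ^ _)%:R) natrX -exprM.
  by apply: (qI_congX qI_prime) Ic; [apply: (OK_zp zpP)|apply: OK_nat].
have /dvdAP[t Zt tE] := qI_intr IN.
by exists s, t; split=> //; rewrite -sE -tE subrK.
Qed.

Definition cofactor c (j : 'I_p.-1) := \prod_(i < p.-1 | i != j) (tau i zp - c%:R).

Lemma Aint_tau_sub i c : tau i zp - c%:R \in Aint.
Proof. by rewrite rpredB ?rpred_nat // Aint_aut (Aint_prim_root zpP). Qed.

Lemma Aint_cofactor c j : cofactor c j \in Aint.
Proof. by rewrite rpred_prod // => i _; apply: Aint_tau_sub. Qed.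

(** The product of all [tau i zp - c] is, up to sign, [1 + c + ... + c ^ p.-1], a multiple of [q] as
    [c] has order [p]. With [qI_gen] this gives the claim times [p], and [p] is removed by
    coprimality with [q]. *)
Lemma qI_cofactor c (j : 'I_p.-1) x : qI (zp - c%:R) -> p.-primitive_root (c%:R : 'F_q) ->
  qI x -> (q%:R %| tau j x * cofactor c j)%A.
Proof.
move=> Ic cP Ix; have [s [t [Zs Zt px]]] := qI_gen Ic Ix.
have Zx : tau j x \in Aint by rewrite Aint_aut; have /OKP[] := qI_OK qI_prime Ix.
have qPhi : (q%:R %| \prod_(i < p.-1) (tau i zp - c%:R))%A.
  rewrite (eq_bigr (fun i : 'I_p.-1 => - (c%:R - tau i zp))) => [|i _]; last by rewrite opprB.
  rewrite prodrN dvdA_mull ?rpredX ?rpredN ?rpred1 //.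
  rewrite (prod_sub_tau pr_p zpP vP sig).
  rewrite (_ : \sum_(i < p) _ = (\sum_(i < p) c ^ i)%N%:R); last first.
    by rewrite natr_sum; apply: eq_bigr => i _; rewrite natrX.
  rewrite -eqAmod0 (eqAmod0_nat q) /dvdn -[X in _ == X](mod0n q) -Fp_natr_eq //.
  rewrite natr_sum; under eq_bigr do rewrite natrX.
  rewrite sum_exp_eq1 ?(prim_expr_order cP) //.
  by rewrite -(prim_order_dvd cP 1) dvdn1 gtn_eqF ?prime_gt1.
have qpx : (q%:R %| p%:R * (tau j x * cofactor c j))%A.
  have -> : p%:R * (tau j x * cofactor c j) =
      (\prod_(i < p.-1) (tau i zp - c%:R)) * tau j s + q%:R * (tau j t * cofactor c j).
    rewrite (bigD1 j) //= -/(cofactor c j) mulrA.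
    have -> : p%:R * tau j x = (tau j zp - c%:R) * tau j s + q%:R * tau j t.
      by rewrite -(rmorph_nat (tau j) p) -rmorphM px rmorphD !rmorphM rmorphB !rmorph_nat.
    by ring.
  apply: rpredD; apply: dvdA_mulr; rewrite ?dvdAA ?Aint_aut //.
  by rewrite rpredM ?Aint_cofactor ?Aint_aut.
have qqx : (q%:R %| q%:R * (tau j x * cofactor c j))%A.
  by rewrite dvdA_mulr ?dvdAA // rpredM ?Aint_cofactor.
have co : coprime p q by rewrite prime_coprime // dvdn_prime2 //; apply/eqP/nesym.
case: (egcdnP q (prime_gt0 pr_p)) => a b e _; move: e; rewrite (eqP co) => e.
have -> : tau j x * cofactor c j = a%:R * (p%:R * (tau j x * cofactor c j))
   - b%:R * (q%:R * (tau j x * cofactor c j)).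
  rewrite !mulrA -!natrM e natrD; ring.
by apply: rpredB; apply: dvdA_mull; rewrite ?rpred_nat.
Qed.

Lemma ipow_cofactor c (j : 'I_p.-1) n x : qI (zp - c%:R) -> p.-primitive_root (c%:R : 'F_q) ->
  ipow (OK zp) qI n x -> (q%:R ^+ n %| tau j x * cofactor c j ^+ n)%A.
Proof.
move=> Ic cP; elim: n x => [|n IH] x.
  move=> /OKP[_ Zx]; apply/dvdAP; exists (tau j x); rewrite ?Aint_aut //.
  by rewrite mulr1 mul1r.
case=> s [sP ->]; rewrite rmorph_sum mulr_suml big_seq rpred_sum // => ab /sP[h1 h2].
rewrite rmorphM /= !exprS mulrACA dvdA_mul //; last exact: IH.
exact: qI_cofactor.
Qed.

Definition Knorm : algC := \prod_(i < p.-1) tau i A.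

Lemma Aint_A : A \in Aint. Proof. by case/OKP: OA. Qed.
Lemma Kp_A : A \in Kp zp. Proof. by case/OKP: OA. Qed.

Lemma dvdA_A_qI x : qI x -> (A %| x ^+ p)%A.
Proof.
move=> Ix; have := dvdA_ipow_expn p Ix (@qI_OK _ _ qI_prime).
by move/AqI=> [r [/OKP[_ Zr] ->]]; rewrite dvdA_mulr ?dvdAA.
Qed.

(** Each conjugate of [A] divides the [p]-th power of the matching [tau k zp - c], and these powers
    are comaximal. *)
Lemma comaximal_tau_A i j : (i < p.-1)%N -> (j < p.-1)%N -> i != j ->
  comaximal (tau i A) (tau j A).
Proof.
move=> ip jp ij; have [c [Ic cP pc]] := qI_zp_residue pr_p zpP pr_q qp qI_prime qIq qI_norm.
have H k : (tau k A %| (tau k zp - c%:R) ^+ p)%A.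
  have -> : (tau k zp - c%:R) ^+ p = tau k ((zp - c%:R) ^+ p).
    by rewrite rmorphXn rmorphB rmorph_nat.
  exact/rmorph_dvdA/dvdA_A_qI.
apply: (comaximal_dvdW (H i) (H j)).
apply: comaximalX; rewrite ?rpredX ?Aint_tau_sub //; apply: comaximalC.
by apply: comaximalX; rewrite ?Aint_tau_sub //; apply/comaximalC/comaximal_tau_sub.
Qed.

Lemma Knorm_dvdA : (Knorm %| q%:R ^+ p)%A.
Proof.
rewrite /Knorm; apply: prod_comaximal_dvdA; rewrite ?index_enum_uniq ?rpredX ?rpred_nat //.
- by move=> i; rewrite Aint_aut Aint_A.
- by move=> i j _ _ ij; apply: comaximal_tau_A.
- move=> i _; have -> : q%:R ^+ p = tau i (q%:R ^+ p) by rewrite rmorphXn rmorph_nat.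
  exact/rmorph_dvdA/dvdA_A_qI.
Qed.

(** Let [nu] be a [p]-th root of the norm. Membership of [A] in the [p]-th power of [qI] shows that
    [q] divides [nu * cofactor c j] for every [j]; the cofactors generate the unit ideal, so [q]
    divides [nu]. *)
Lemma dvdA_Knorm : (q%:R ^+ p %| Knorm)%A.
Proof.
have [c [Ic cP pc]] := qI_zp_residue pr_p zpP pr_q qp qI_prime qIq qI_norm.
have p0 := prime_gt0 pr_p.
have ZN : Knorm \in Aint by rewrite rpred_prod // => i _; rewrite Aint_aut Aint_A.
pose nu := p.-root Knorm; have nuE : nu ^+ p = Knorm by rewrite rootCK.
have Znu : nu \in Aint by apply: (Aint_root p0); rewrite nuE.
rewrite -nuE; apply: dvdA_exp.
apply: (@dvdA_cofactors _ (index_enum 'I_p.-1) (fun i => tau i zp - c%:R)).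
- exact: index_enum_uniq.
- have p1 : (0 < p.-1)%N by have := prime_gt1 pr_p; lia.
  by apply: contraTneq (mem_index_enum (Ordinal p1)) => ->.
- by move=> i; apply: Aint_tau_sub.
- by [].
- by move=> i j _ _ ij; apply: comaximal_tau_sub.
- move=> j _; rewrite -/(cofactor c j); apply: (dvdA_exp_root p0).
  rewrite exprMn nuE /Knorm (bigD1 j) //= mulrAC dvdA_mulr //.
    apply: ipow_cofactor => //; apply/AqI; exists 1; split; last by rewrite mulr1.
    exact: (OK_nat zp 1).
  by rewrite rpred_prod // => i _; rewrite Aint_aut Aint_A.
Qed.
End Conjugates.

(** * Evaluation of the [p ^ 2]-th power of the Gauss sum *)

Lemma addn_Fp_opp p (y : 'F_p) : prime p -> y != 0 -> (y + (- y)%R)%N = p.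
Proof.
move=> pr_p y0; have pd : (p %| y + (- y)%R)%N.
  by rewrite /dvdn -[X in _ == X](mod0n p) -Fp_natr_eq // natrD !natr_Fp subrr.
have y1 : (0 < y)%N by rewrite lt0n; exact: y0.
have := ltn_Fp y pr_p; have := ltn_Fp (- y) pr_p.
case/dvdnP: pd => -[|[|d]] e; rewrite e; lia.
Qed.

Lemma primitive_root_mod_neq0 p v : primitive_root_mod p v -> v%:R != 0 :> 'F_p.
Proof. exact: prim_root_neq0. Qed.

Lemma mulz_eq1 (m n : int) : m * n = 1 -> m = 1 \/ m = -1.
Proof.
move=> mn; have : (`|m| * `|n|)%N == 1%N by rewrite -abszM mn.
by rewrite muln_eq1 => /andP[/eqP m1 _]; lia.
Qed.

Section GaussPower.
Variables (p : nat) (zp : algC) (v : nat) (sigma : {rmorphism algC -> algC}).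
Hypotheses (pr_p : prime p) (odd_p : odd p) (zpP : p.-primitive_root zp).
Hypotheses (vP : primitive_root_mod p v) (sig : sigma zp = zp ^+ v).
Variables (q : nat) (zq : algC) (qI : algC -> Prop).
Hypotheses (pr_q : prime q) (qp : q <> p) (zqP : q.-primitive_root zq).
Hypotheses (qI_prime : prime_ideal (OK zp) qI) (qIq : qI q%:R).
Hypothesis qI_norm : ideal_norm (OK zp) qI q.
Variable A : algC.
Hypotheses (OA : OK zp A) (AqI : ideal_eq (pideal (OK zp) A) (ipow (OK zp) qI p)).

Local Notation tau := (itermor sigma).
Local Notation pi := (zp - 1).
Local Notation g := (gauss p zq qI q).
Local Notation ch x := (chi p qI q (nat_of_ord (x : 'F_q))).
Local Notation N := (Knorm p sigma A).
Local Notation B := (Psigma p v sigma A).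

Lemma gaussE : g = gsum zq (fun x => ch x).
Proof. by rewrite /gsum (big_Fp _ _ (fun x => chi p qI q x * zq ^+ x) pr_q). Qed.

Lemma ch_unity x : x != 0 -> ch x ^+ p = 1.
Proof. by move=> x0; apply: chi_unity_root zpP _ _ _ _ _ _ x0. Qed.

Lemma gauss_norm : g * g^* = q%:R.
Proof.
rewrite gaussE; apply: gsum_norm => //.
- exact: chi0.
- by move=> x y; apply: (chiM pr_p zpP).
- move=> x /ch_unity x1; rewrite (conj_unity_root (prime_gt0 pr_p) x1) divff //.
  by apply: contra_eq_neq x1 => ->; rewrite expr0n eqn0Ngt prime_gt0 // eq_sym oner_eq0.
- exact: (chi_nontrivial pr_p zpP).
Qed.

Lemma gauss_exp_Kp : g ^+ p \in Kp zp.
Proof.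
rewrite gaussE; apply: gsum_exp_Kp => //.
- by move=> x y; apply: (chiM pr_p zpP).
- by move=> x; have /OKP[] := OK_chi pr_p zpP pr_q qp qI_prime qIq qI_norm x.
- exact: ch_unity.
- exact: prime_gt0.
Qed.

Lemma Aint_gauss : g \in Aint.
Proof.
rewrite gaussE rpred_sum // => x _; rewrite rpredM ?rpredX ?(Aint_prim_root zqP) //.
by have /OKP[] := OK_chi pr_p zpP pr_q qp qI_prime qIq qI_norm x.
Qed.

(** Every nonzero value of [chi] is a power of [zp], so 1 modulo [pi], and the nontrivial powers of
    [zq] sum to -1. *)
Lemma gauss_eqAmod_pi : (g == -1 %[mod pi])%A.
Proof.
have s0 : \sum_(x : 'F_q) zq ^+ x = 0.
  have e := sum_exp_Fp pr_q zqP 1; rewrite oner_eq0 in e; rewrite -[RHS]e.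
  by apply: eq_bigr => x _; rewrite mul1r.
have s1 : \sum_(x : 'F_q | x != 0) zq ^+ x = -1.
  by move: s0; rewrite (bigD1 0) //= expr0 => /eqP; rewrite addrC addr_eq0 => /eqP.
have gE : g = \sum_(x : 'F_q | x != 0) ch x * zq ^+ x.
  by rewrite gaussE [LHS](bigD1 0) // chi0 mul0r; apply: add0r.
have -> : (g == -1 %[mod pi])%A = (pi %| g - -1)%A by [].
have -> : g - -1 = \sum_(x : 'F_q | x != 0) (ch x * zq ^+ x - zq ^+ x).
  by rewrite sumrB s1 gE.
apply: rpred_sum => x x0.
rewrite -[X in _ - X]mul1r -mulrBl.
apply: dvdA_mulr; last by rewrite rpredX ?(Aint_prim_root zqP).
have [a ->] := prim_rootP zpP (ch_unity x0).
by apply: eqAmod_pow1; apply: Aint_prim_root zpP.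
Qed.

Lemma gauss_exp_eqAmod : (g ^+ (p ^ 2) == -1 %[mod (pi ^+ 2)%R])%A.
Proof.
have Zm1 : -1 \in Aint by rewrite rpredN rpred1.
have := eqAmod_pi_exp pr_p zpP Aint_gauss Zm1 (isT : 0 < 1)%N gauss_eqAmod_pi.
rewrite -signr_odd odd_p expr1 => /(eqAmodX p (rpredX p Aint_gauss) Zm1).
by rewrite -exprM -signr_odd odd_p expr1.
Qed.

(** The action of [sigma] on [zq] is arbitrary, so the conjugate is a Gauss sum of a power of [chi]
    for another root of unity [tau i zq]. *)
Lemma tau_gauss i : tau i g = \sum_(x : 'F_q) ch x ^+ (v%:R ^+ i : 'F_p) * (tau i zq) ^+ x.
Proof.
rewrite gaussE rmorph_sum; apply: eq_bigr => x _; rewrite rmorphM rmorphXn /=.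
congr (_ * _); have [->|x0] := eqVneq x 0.
  rewrite chi0 rmorph0 expr0n eqn0Ngt lt0n.
  by rewrite (_ : _ != 0%N) //; exact: (expf_neq0 i (primitive_root_mod_neq0 vP)).
have [a ->] := prim_rootP zpP (ch_unity x0).
by rewrite rmorphXn /= (tau_zp pr_p zpP sig) exprAC.
Qed.

Lemma vpowN i : vpow p v (- i%:Z) = ((v%:R ^+ i)^-1 : 'F_p).
Proof. by rewrite /vpow exprnN. Qed.

Lemma dvdA_tau_gauss i : (i < p.-1)%N ->
  (tau i A ^+ vpow p v (- i%:Z) %| g ^+ (p ^ 2))%A.
Proof.
(* With [t] the residue of [v ^ j], that is of [v ^ - i], the lower bound gives that [A ^+ t]
   divides [tau j g ^+ (p ^ 2)]. Then [tau i] is applied: [tau p.-1] fixes the cyclotomic field,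
   which contains [g ^+ (p ^ 2)]. *)
move=> ip; pose j := (p.-1 - i)%N.
have ij : (i + j = p.-1)%N by rewrite subnKC // ltnW.
have -> : vpow p v (- i%:Z) = (v%:R ^+ j : 'F_p).
  rewrite vpowN; congr (nat_of_ord _).
  apply: (mulfI (expf_neq0 i (primitive_root_mod_neq0 vP))).
  by rewrite divff ?expf_neq0 ?primitive_root_mod_neq0 // -exprD ij (prim_expr_order vP).
set t := (v%:R ^+ j : 'F_p).
have t0 : (0 < t)%N by rewrite lt0n; exact: (expf_neq0 j (primitive_root_mod_neq0 vP)).
have pp0 : (0 < p ^ 2)%N by rewrite expn_gt0 prime_gt0.
pose gam := (p ^ 2).-root A; have gA : gam ^+ (p ^ 2) = A by rewrite rootCK.
have Zg : gam \in Aint by apply: (Aint_root pp0); rewrite gA; case/OKP: OA.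
have := @gauss_lower_bound p zp q qI pr_p zpP pr_q qp qI_prime qIq qI_norm t gam A (tau j zq).
rewrite fmorph_primitive_root => /(_ zqP Zg gA).
move=> /(_ (dvdA_A_qI qI_prime AqI)); rewrite t0 ltn_Fp // => /(_ isT).
rewrite -tau_gauss => /(@dvdA_exp (p ^ 2)); rewrite exprAC gA => /(rmorph_dvdA (tau i)).
rewrite !rmorphXn /= -itermorD ij.
suff -> : itermor sigma p.-1 g ^+ (p ^ 2) = g ^+ (p ^ 2) by [].
rewrite -rmorphXn /= (tau_eq_mod (j := 0) pr_p zpP vP sig) ?modnn ?mod0n //.
by rewrite expnS expn1 exprM rpredX // gauss_exp_Kp.
Qed.

Lemma PsigmaE x : Psigma p v sigma x = \prod_(i < p.-1) tau i x ^+ vpow p v (- i%:Z).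
Proof. by apply: eq_bigr => i _; rewrite itermorE. Qed.

Lemma dvdA_Psigma_gauss : (B %| g ^+ (p ^ 2))%A.
Proof.
rewrite PsigmaE; apply: prod_comaximal_dvdA.
- exact: index_enum_uniq.
- by move=> i; rewrite rpredX // Aint_aut (Aint_A OA).
- move=> i j _ _ ij.
  have ZA k : tau k A \in Aint by rewrite Aint_aut (Aint_A OA).
  apply: comaximalX; rewrite ?rpredX //; apply/comaximalC/comaximalX => //.
  apply: comaximalC.
  by apply: (comaximal_tau_A pr_p zpP vP sig pr_q qp qI_prime qIq qI_norm AqI).
- by rewrite rpredX // Aint_gauss.
- by move=> i _; apply: dvdA_tau_gauss.
Qed.

Lemma Psigma_neq0 : A != 0 -> B != 0.
Proof.
move=> A0; rewrite PsigmaE; apply/prodf_neq0 => i _.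
by rewrite expf_neq0 // fmorph_eq0.
Qed.

Lemma A_neq0 : A != 0.
Proof.
have := dvdA_A_qI qI_prime AqI qIq; apply: contraTneq => ->.
by rewrite unfold_in eqxx expf_eq0 prime_gt0 //= pnatr_eq0 -lt0n prime_gt0.
Qed.

(* Conjugates indexed by the residue class a for which zp |-> zp ^+ a. *)
Section FpIndexing.
Variable c : seq rat.
Hypothesis cA : A = ratpoly c zp.
Local Notation Ac a := (ratpoly c (zp ^+ (nat_of_ord (a : 'F_p)))).

Lemma tau_A i : tau i A = Ac (v%:R ^+ i).
Proof. by rewrite cA rmorph_ratpoly (tau_zp pr_p zpP sig). Qed.

Lemma Knorm_Fp : N = \prod_(a : 'F_p | a != 0) Ac a.
Proof.
rewrite /Knorm; under eq_bigr do rewrite tau_A.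
exact: (big_primitive_root_mod _ (fun a => Ac a) pr_p vP).
Qed.

Lemma Psigma_Fp : B = \prod_(a : 'F_p | a != 0) Ac a ^+ (a^-1 : 'F_p).
Proof.
rewrite PsigmaE; under eq_bigr do rewrite tau_A vpowN.
exact: (big_primitive_root_mod _ (fun a => Ac a ^+ (a^-1 : 'F_p)) pr_p vP).
Qed.

Lemma conj_Ac a : (Ac a)^* = Ac (- a).
Proof.
have zaV : (zp ^+ a)^* = (zp ^+ a)^-1.
  apply: (conj_unity_root (prime_gt0 pr_p)).
  by rewrite exprAC (prim_expr_order zpP) expr1n.
rewrite rmorph_ratpoly; congr ratpoly; apply: (etrans zaV).
apply: (mulfI (expf_neq0 a (prim_root_neq0 zpP))).
rewrite divff ?expf_neq0 ?(prim_root_neq0 zpP) //.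
by rewrite -(exp_FpD pr_p zpP) subrr expr0.
Qed.

(** Conjugation exchanges the indices [a] and [- a], and the integers representing their inverses
    add up to [p]. *)
Lemma Psigma_norm : B * B^* = N ^+ p.
Proof.
have -> : B^* = \prod_(a : 'F_p | a != 0) Ac a ^+ ((- a)^-1 : 'F_p).
  rewrite Psigma_Fp rmorph_prod [RHS](reindex_inj oppr_inj) /=.
  by apply: eq_big => a; rewrite ?oppr_eq0 // rmorphXn /= conj_Ac opprK.
rewrite Psigma_Fp Knorm_Fp -big_split -prodrXl /=; apply: eq_bigr => a a0.
by rewrite -exprD invrN addn_Fp_opp ?invr_eq0.
Qed.

Lemma tau_Knorm i : tau i N = N.
Proof.
rewrite Knorm_Fp rmorph_prod.
have vi0 := expf_neq0 i (primitive_root_mod_neq0 vP).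
rewrite [RHS](reindex_inj (mulfI vi0)); apply: eq_big => a /=.
  by rewrite mulf_eq0 (negPf vi0).
by rewrite rmorph_ratpoly rmorphXn /= (tau_zp pr_p zpP sig) (exp_FpM pr_p zpP).
Qed.
End FpIndexing.

Lemma A_ratpoly : exists c, A = ratpoly c zp.
Proof. by case: OA. Qed.

(** The norm is rational, and it and [q ^ p] divide each other, so they agree up to sign. The sign
    is positive because [N ^+ p = B * B^*] is nonnegative and [p] is odd. *)
Lemma Knorm_eq : N = q%:R ^+ p.
Proof.
have [c cA] := A_ratpoly.
have KN : N \in Kp zp.
  by rewrite rpred_prod // => i _; apply: (tau_Kp pr_p zpP sig); apply: Kp_A OA.
have p1 : (p.-1)%:R != 0 :> algC.
  by rewrite pnatr_eq0; have := prime_gt1 pr_p; lia.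
have QN : N \in Crat.
  have := trace_Crat pr_p zpP vP sig KN; rewrite /trace.
  under eq_bigr do rewrite (tau_Knorm cA).
  rewrite sumr_const card_ord -[_ *+ _]mulr_natl => h.
  by rewrite -[N](mulKf p1) rpredM ?rpredV ?rpred_nat.
have q0 : q%:R ^+ p != 0 :> algC by rewrite expf_neq0 // pnatr_eq0 -lt0n prime_gt0.
have /dvdAP[s Zs Ns] := dvdA_Knorm pr_p zpP vP sig pr_q qp qI_prime qIq qI_norm OA AqI.
have /dvdAP[t Zt qt] := Knorm_dvdA pr_p zpP vP sig pr_q qp qI_prime qIq qI_norm OA AqI.
have st : s * t = 1 by apply: (mulfI q0); rewrite mulrA -Ns -qt mulr1.
have s0 : s != 0 by apply: contra_eq_neq st => ->; rewrite mul0r eq_sym oner_eq0.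
have Qs : s \in Crat by rewrite -[s](mulKf q0) -Ns rpredM ?rpredV ?rpredX ?rpred_nat.
have Qt : t \in Crat by rewrite -[t](mulKf s0) st mulr1 rpredV.
have /intrP[m sm] := Cint_rat_Aint Qs Zs; have /intrP[n tn] := Cint_rat_Aint Qt Zt.
have mn : m * n = 1.
  by move: st; rewrite sm tn -intrM => /eqP; rewrite -[1]/(1%:~R) eqr_int => /eqP.
have Np : 0 <= N ^+ p by rewrite -(Psigma_norm cA) mul_conjC_ge0.
have [m1|m1] := mulz_eq1 mn.
  by rewrite Ns sm m1 mulr1.
move: Np; rewrite Ns sm m1 rmorphN1 mulrN1 exprNn -signr_odd odd_p expr1 mulN1r oppr_ge0.
by rewrite lt_geF // !exprn_gt0 // ltr0n prime_gt0.
Qed.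

Lemma Kp_conj x : x \in Kp zp -> x^* \in Kp zp.
Proof.
move=> /KpP[c ->]; rewrite rmorph_sum rpred_sum // => i _.
rewrite rmorphM rmorphXn /= fmorph_rat rpredM ?rpredX //.
  by rewrite Kp_Crat ?Crat_rat.
rewrite (conj_unity_root (prime_gt0 pr_p) (prim_expr_order zpP)).
have -> : zp^-1 = zp ^+ p.-1.
  apply: (mulfI (prim_root_neq0 zpP)); rewrite divff ?(prim_root_neq0 zpP) //.
  by rewrite -exprS prednK ?prime_gt0 // (prim_expr_order zpP).
by rewrite rpredX ?Kp_gen.
Qed.

Lemma Psigma_Kp : B \in Kp zp.
Proof.
rewrite PsigmaE rpred_prod // => i _; rewrite rpredX //.
by apply: (tau_Kp pr_p zpP sig); apply: Kp_A OA.
Qed.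

(** [pi] divides each of its conjugates, so every conjugate of [A] is also 1 modulo [pi ^+ k]. *)
Lemma Psigma_eqAmod k : (pi ^+ k %| A - 1)%A -> (B == 1 %[mod (pi ^+ k)%R])%A.
Proof.
move=> dA; rewrite PsigmaE.
have ZA i : tau i A \in Aint by rewrite Aint_aut (Aint_A OA).
suff [] : \prod_(i < p.-1) tau i A ^+ vpow p v (- i%:Z) \in Aint /\
  (\prod_(i < p.-1) tau i A ^+ vpow p v (- i%:Z) == 1 %[mod (pi ^+ k)%R])%A by [].
apply: (big_ind (fun x => x \in Aint /\ (x == 1 %[mod (pi ^+ k)%R])%A)).
- by [].
- move=> x y [Zx x1] [Zy y1]; rewrite rpredM //; split=> //.
  by have := eqAmodM Zx Aint1 x1 y1; rewrite mulr1.
- move=> i _; rewrite rpredX //; split=> //.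
  have := rmorph_dvdA (tau i) dA; rewrite rmorphB rmorph1 rmorphXn rmorphB rmorph1.
  move/(dvdA_trans (dvdA_exp k (dvdA_pi_tau pr_p zpP sig i))).
  by move/(eqAmodX (vpow p v (- i%:Z)) (ZA i) Aint1); rewrite expr1n.
Qed.

Lemma gauss_exp_eq_Psigma :
  (pi ^+ 2 %| A - 1)%A -> g ^+ (p ^ 2) = - B.
Proof.
move=> dA; have [c cA] := A_ratpoly; have B0 := Psigma_neq0 A_neq0.
have /dvdAP[u Zu gu] := dvdA_Psigma_gauss.
have Bq : B * B^* = q%:R ^+ (p ^ 2) by rewrite (Psigma_norm cA) Knorm_eq -exprM.
have q0 : q%:R ^+ (p ^ 2) != 0 :> algC.
  by rewrite expf_neq0 // pnatr_eq0 -lt0n prime_gt0.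
have uu : u * u^* = 1.
  apply: (mulfI q0); rewrite mulr1 -{1}Bq mulrACA -rmorphM -gu rmorphXn /=.
  by rewrite -exprMn gauss_norm.
have Ku : u \in Kp zp.
  have -> : u = (q%:R ^+ (p ^ 2))^-1 * (g ^+ (p ^ 2) * B^*).
    by apply: (mulfI q0); rewrite mulVKf // gu -Bq; ring.
  apply: rpredM; first by rewrite Kp_Crat ?rpredV ?rpredX ?rpred_nat.
  apply: rpredM.
    by rewrite expnS expn1 exprM rpredX // gauss_exp_Kp.
  exact/Kp_conj/Psigma_Kp.
suff u1 : - u = 1 by rewrite gu -[u]opprK u1 mulrN1.
apply: (Kp_unit_eq1 pr_p zpP vP sig); rewrite ?rpredN //.
  (* Conjugation commutes with [tau i] on the field, so [u * u^* = 1] passes to every conjugate of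
     [u]. *)
  move=> i; rewrite rmorphN normrN; apply/eqP.
  rewrite -(@pexpr_eq1 _ _ 2) // normCK -(tau_conj sigma pr_p zpP) //.
  by rewrite -rmorphM uu rmorph1.
(* Modulo [pi ^+ 2], [u] agrees with [u * B = g ^+ (p ^ 2)], which is -1. *)
rewrite eqAmodN; apply: (eqAmod_trans (y := u * B)); last first.
  by rewrite mulrC -gu; apply: gauss_exp_eqAmod.
rewrite -{1}[u]mulr1; apply: eqAmodMl => //; rewrite eqAmod_sym.
exact: Psigma_eqAmod.
Qed.
End GaussPower.

Theorem mainTheorem7
  (p : nat) (zp : algC) (v : nat) (sigma : {rmorphism algC -> algC})
  (m : nat) (Gam : (algC -> Prop) -> Prop)
  (q : nat) (zq : algC) (qI : algC -> Prop) (A D : algC) :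
  (* p odd prime, zp primitive p-th root of unity *)
  prime p -> odd p -> p.-primitive_root zp ->
  (* v primitive root mod p, sigma : zp |-> zp^v *)
  primitive_root_mod p v -> sigma zp = zp ^+ v ->
  (* p irregular, p does not divide h(K_p^+) *)
  (exists h, class_number (OK zp) h /\ (p %| h)%N) ->
  (exists h, class_number (OKplus zp) h /\ ~~ (p %| h)%N) ->
  (* 1 <= m <= (p-3)/2 *)
  (1 <= m <= (p - 3)./2)%N ->
  (* Gam: a subgroup of order p of C_p, annihilated by sigma - mu,
     given as the family of nonzero ideals whose class lies in it *)
  (forall I, Gam I -> nzideal (OK zp) I) ->
  (forall I J, Gam I -> nzideal (OK zp) J -> iequiv (OK zp) I J -> Gam J) ->
  Gam (OK zp) ->
  (forall I J, Gam I -> Gam J -> Gam (iprod I J)) ->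
  (forall I, Gam I -> exists2 J, Gam J & is_principal (OK zp) (iprod I J)) ->
  (forall I, Gam I -> exists k, is_principal (OK zp) (ipow (OK zp) I (p ^ k))) ->
  nclasses (OK zp) Gam p ->
  (forall I, Gam I ->
     iequiv (OK zp) (iimage sigma I) (ipow (OK zp) I (vpow p v (2 * m + 1)%N))) ->
  (* q odd prime, q <> p, zq primitive q-th root of unity *)
  prime q -> odd q -> q <> p -> q.-primitive_root zq ->
  (* qI non-principal prime ideal of inertial degree 1 over q, class in Gam *)
  prime_ideal (OK zp) qI -> qI q%:R -> ideal_norm (OK zp) qI q ->
  ~ is_principal (OK zp) qI -> Gam qI ->
  (* A *)
  OK zp A -> ideal_eq (pideal (OK zp) A) (ipow (OK zp) qI p) ->
  (exists alpha, inKp zp alpha /\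
     sigma A = A ^+ vpow p v (2 * m + 1)%N * alpha ^+ p) ->
  pi_exact zp (2 * m + 1) (A - 1) ->
  OKplus zp D -> A * A^* = D ^+ p ->
  (gauss p zq qI q / (gauss p zq qI q)^*) ^+ (p ^ 2) =
  Psigma p v sigma (A ^+ 2 / D ^+ p).
Proof.
move=> pr_p odd_p zpP vP sig _ _ /andP[m1 _] _ _ _ _ _ _ _ _.
move=> pr_q _ qp zqP qIp qIq qIN _ _ OA AqI _ [piA _] [[KD DD] ZD] AD.
have A0 := A_neq0 pr_p pr_q qIp qIq AqI.
(* Here [1 <= m] gives [2 <= 2 * m + 1]. *)
have dA : ((zp - 1) ^+ 2 %| A - 1)%A.
  apply: dvdA_trans (in_pi_pow_dvdA (Aint_prim_root zpP) piA).
  by apply: dvdA_expW; rewrite ?rpredB ?(Aint_prim_root zpP) //; lia.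
have gB := gauss_exp_eq_Psigma pr_p odd_p zpP vP sig pr_q qp zqP qIp qIq qIN OA AqI dA.
(* The minus sign of [g ^+ (p ^ 2) = - B] cancels in the quotient by the conjugate. *)
rewrite exprMn exprVn -rmorphXn /= gB rmorphN invrN mulrNN.
have -> : A ^+ 2 / D ^+ p = A / A^*.
  by rewrite -AD expr2 invfM mulrACA divff ?mul1r.
have tau_A i : itermor sigma i A^* = (itermor sigma i A)^*.
  by apply: (tau_conj sigma pr_p zpP); apply: Kp_A OA.
rewrite !PsigmaE rmorph_prod -prodfV -big_split /=; apply: eq_bigr => i _.
by rewrite rmorphM fmorphV tau_A exprMn exprVn rmorphXn.
Qed.
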